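(* Let $\rho_{\max}>0$, $\eta>0$ and $b\in\mathbb{R}$. Let $v\in C^2([0,\rho_{\max}];[0,\infty))$ satisfy $v'<0$ on $[0,\rho_{\max}]$, and let $v'_{\max}<0$ be a constant such that $v'(r)\le v'_{\max}<0$ for all $r\in[0,\rho_{\max}]$. Let $0\le \bar v<v(0)$ be a given equilibrium velocity with $\bar\rho:=v^{-1}(\bar v)\in(0,\rho_{\max}]$. Let $\rho_0\in BV(\mathbb{R};(0,\rho_{\max}])$ be strictly positive initial data with $\rho_0(x)=\bar\rho$ for all $x\ge b$, and set $\rho_{\min}:=\inf_{x\in\mathbb{R}}\rho_0(x)$. Let $\rho$ be the unique weak solution of $$\partial_t\rho(t,x)+\partial_x\big(\rho(t,x)V(t,x)\big)=0,\qquad (t,x)\in(0,\infty)\times\mathbb{R},\qquad \rho(0,\cdot)=\rho_0,$$ $$V(t,x):=v\left(\frac1\eta\int_x^{x+\eta}\rho(t,y)\,dy\right).$$ Set $\beta(t):=b+\bar v\,t$ and define $$L(t):=\int_{\beta(t)-\eta}^{\beta(t)}\big(V(t,x)-\bar v\big)^2\,dx .$$ Then for all $t\ge 0$ $$L(t)\le L(0)\,\exp\left(\frac{2}{\eta}\,v'_{\max}\,\rho_{\min}\,t\right).$$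
   Context: This is the nonlocal Lighthill-Whitham-Richards traffic model with the constant convolution kernel $W_\eta(x)=\frac1\eta$ on $[0,\eta]$; $\rho$ is the traffic density, $v$ the velocity function, $V$ the nonlocal velocity and $\eta>0$ the nonlocal reach. $BV(\mathbb{R};(0,\rho_{\max}])$ denotes functions $\mathbb{R}\to(0,\rho_{\max}]$ of bounded total variation (they are bounded, and integrability over $\mathbb{R}$ is not required). ''Weak solution'' is meant in the usual distributional sense, with values in $[0,\rho_{\max}]$, so that $V$ is defined, and continuous in time with values in $L^1_{\mathrm{loc}}(\mathbb{R})$. The following facts are known from the literature and are taken for granted. For such initial data a weak solution exists and is unique, without any entropy condition. It satisfies the maximum principle $\rho_{\min}\le\rho(t,x)\le\sup_{x\in\mathbb{R}}\rho_0(x)\le\rho_{\max}$. The curve $\beta(t)=b+\bar v t$ is the characteristic starting at $x=b$ and represents a leading vehicle moving with speed $\bar v$. The solution is equal to $\bar\rho$ for $x\ge\beta(t)$. Equivalently, the problem is viewed as an initial boundary value problem on $(-\infty,\beta(t)]$ with the density set to $\bar\rho$ for $x\ge\beta(t)$. *)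

(* Defs.v *)
From HB Require Import structures.
From mathcomp Require Import all_boot all_order all_algebra.
From mathcomp Require Import all_classical all_reals all_analysis.

Set Implicit Arguments.
Unset Strict Implicit.
Unset Printing Implicit Defensive.

Import Order.TTheory GRing.Theory Num.Theory.
Import numFieldNormedType.Exports.

Local Open Scope classical_set_scope.
Local Open Scope ring_scope.

Section nonlocal_traffic.
Context {R : realType}.
Implicit Types (f v : R -> R) (rho phi : R -> R -> R).

Local Notation mu := (@lebesgue_measure R).

(* The difference quotient is restricted to D, so this is the one-sided
   derivative at an end point of an interval D. *)
Definition has_derivative_on (D : set R) f (f' : R -> R) : Prop :=
  forall x, D x -> (fun y => (f y - f x) / (y - x)) @ within D x^' --> f' x.

(* f is of class C^2 on D, with first derivative f'. *)
Definition C2_on (D : set R) f (f' : R -> R) : Prop :=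
  has_derivative_on D f f' /\
  exists f'' : R -> R, has_derivative_on D f' f'' /\ {within D, continuous f''}.

Definition bounded_total_variation f : Prop :=
  exists M : R, forall a b : R, a <= b -> (total_variation a b f <= M%:E)%E.

(* Functions of (t, x) are curried, time first. *)

Definition nonlocal_velocity v (eta : R) rho (t x : R) : R :=
  v (eta^-1 * \int[mu]_(y in `[x, x + eta]) rho t y).

(* C^1_c((0, +oo) x R): continuous partial derivatives and support in
   [a, M] x [-M, M] for some a > 0. *)
Definition test_function phi : Prop :=
  [/\ forall t x, derivable (phi ^~ x) t 1 /\ derivable (phi t) x 1,
      continuous (fun z : R * R => derive1 (phi ^~ z.2) z.1),
      continuous (fun z : R * R => derive1 (phi z.1) z.2) &
      exists a M : R, 0 < a /\
        forall t x, phi t x != 0 -> a <= t <= M /\ `|x| <= M].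

Definition continuous_L1loc rho : Prop :=
  forall t a b : R, 0 <= t ->
    (fun s => \int[mu]_(x in `[a, b]) `|rho s x - rho t x|)
      @ within [set s | 0 <= s] (nbhs t) --> (0 : R).

(* Weak solution of d_t rho + d_x (rho V) = 0 on (0, +oo) x R with
   rho(0, .) = rho0, where V is the nonlocal velocity. The initial datum is
   attained in the sense of C([0, +oo); L^1_loc(R)). *)
Record weak_solution (rhomax eta : R) v (rho0 : R -> R) rho : Prop := {
  weak_solution_measurable :
    measurable_fun ([set t : R | 0 <= t] `*` [set: R])
      (fun z : R * R => rho z.1 z.2);
  weak_solution_range : forall t, 0 <= t ->
    {ae mu, forall x, 0 <= rho t x <= rhomax};
  weak_solution_continuous : continuous_L1loc rho;
  weak_solution_initial : {ae mu, forall x, rho 0 x = rho0 x};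
  weak_solution_equation : forall phi, test_function phi ->
    \int[mu]_(t in `]0, +oo[) \int[mu]_x
      (rho t x * derive1 (phi ^~ x) t
       + rho t x * nonlocal_velocity v eta rho t x * derive1 (phi t) x) = 0 }.

Definition maximum_principle (rho0 : R -> R) rho : Prop :=
  forall t, 0 <= t ->
    {ae mu, forall x, inf (range rho0) <= rho t x <= sup (range rho0)}.

Definition lyapunov v (eta b vbar : R) rho (t : R) : R :=
  \int[mu]_(x in `[b + vbar * t - eta, b + vbar * t])
    (nonlocal_velocity v eta rho t x - vbar) ^+ 2.

End nonlocal_traffic.

(* Main.v *)
Require Import Defs.
From HB Require Import structures.
From mathcomp Require Import all_boot all_order all_algebra.
From mathcomp Require Import all_classical all_reals all_analysis.
From mathcomp Require Import measurable_realfun.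
From mathcomp Require Import ring lra.

(** Write y = x - b - vbar t for the position relative to the leading vehicle.
In this frame the density r and the velocity V satisfy
r_t + (r (V - vbar))_y = 0.  Once it is known that r = rhobar ahead of the
front y = 0, the decay is pointwise: for -eta <= y <= 0 the far end y + eta of
the averaging window lies in the constant region, where V = vbar, so that the
average W over the window changes only through inflow at y,
W_t = r (V - vbar) / eta.  Hence (V - vbar)^2 solves a linear equation in t
with rate (2 / eta) v'(W) r <= (2 / eta) vmax' rhomin, and integrating over y
gives the claim (velocity_decay, lyapunov_decay).

That the state ahead of the front stays constant is not a hypothesis and has to
be extracted from the weak formulation.  Let m(t, y) be the mass between the
front and y, corrected by the mass that has crossed the front.  Then m_y = r
and m_t = - r (V - vbar), so m is transported by the field V - vbar, and the
defect D = m - rhobar y satisfies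
D_t + (V - vbar) D_y = - rhobar (V - vbar).
The right-hand side at y is at most a constant times |D(y)| + |D(y + eta)|.
The set m > 0 is carried by the flow, contains y + eta whenever it contains y,
and D vanishes on it initially.  A maximum principle for exp(-K t) max(m, 0)^2 D^2 (1 + y^2)^-3
shows that D = 0 wherever m > 0 (front_barrier); a continuity argument in y
then shows that m > 0 for all y > 0 (mass_above_half), whence W = rhobar ahead
of the front (averaged_right_of_front).  Working with max(m, 0) makes any
construction of characteristics unnecessary.

All differential relations are used in a classical form.  The mass is mollified
in space by a tent kernel of width 2 e; integrals of the density against
Lipschitz kernels with compact support are continuous in t because the solution
is continuous in L1loc, so the weak equation turns into honest derivatives in t
(du_bois_reymond, regularized_balance).  The price is an error
O(e) in the transport equation and in the nonlocal average, which disappears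
from the final estimates as e tends to 0.

Two normalizations remove the exceptional null sets and the end points of
[0, rhomax].  The density is truncated to [rhomin, rhomax], which changes it on
a null set for each t (regularized), and v is extended to a C^1 function on the
whole line with the same upper bound on its derivative (velocity_extension). *)

Set Implicit Arguments.
Unset Strict Implicit.
Unset Printing Implicit Defensive.

Import Order.TTheory GRing.Theory Num.Theory.
Import numFieldNormedType.Exports.

Local Open Scope classical_set_scope.
Local Open Scope ring_scope.

(** * Integration of bounded measurable functions with bounded support *)

Section tame_functions.
Context {R : realType}.
Local Notation mu := (@lebesgue_measure R).
Implicit Types (f g h : R -> R) (a b c x y : R).

(** Real-valued, so that domination by a multiple of an interval indicator
and the value of its integral are plain statements in R. *)
Definition window a b x : R := (a <= x <= b)%R%:R.

(** A class closed under the operations used below and contained in L1, so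
that integrability never has to be argued separately. *)
Definition tame f := measurable_fun setT f /\
  exists C N : R, forall x, `|f x| <= C * window (- N) N x.

Definition intR f : R := \int[mu]_x f x.

Lemma window_ge0 a b x : 0 <= window a b x.
Proof. by rewrite /window; case: (_ <= _ <= _). Qed.

Lemma window_le1 a b x : window a b x <= 1.
Proof. by rewrite /window; case: (_ <= _ <= _). Qed.

Lemma window_in a b x : a <= x <= b -> window a b x = 1.
Proof. by rewrite /window => ->. Qed.

Lemma window_out a b x : ~~ (a <= x <= b) -> window a b x = 0.
Proof. by rewrite /window => /negbTE ->. Qed.

Lemma window_sub a b c d x : c <= a -> b <= d -> window a b x <= window c d x.
Proof.
move=> ca bd; rewrite /window; case: (boolP (a <= x <= b)) => [|_] /=; last first.
  by case: (_ <= _ <= _).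
by move=> /andP[ax xb]; rewrite (le_trans ca ax) (le_trans xb bd).
Qed.

Lemma window_indic a b : window a b = \1_(`[a, b]%classic).
Proof. by apply/funext => x; rewrite indicE mem_setE in_itv. Qed.

Lemma measurable_window a b : measurable_fun setT (window a b).
Proof. by rewrite window_indic; exact: measurable_indic. Qed.

Lemma tame_integrable f : tame f -> mu.-integrable setT (EFin \o f).
Proof.
move=> [mf [C [N fC]]].
apply: (@le_integrable _ _ R mu setT measurableT _
  (EFin \o (fun x => C * window (- N) N x))).
- exact/measurable_EFinP.
- move=> x _ /=; rewrite lee_fin (le_trans (fC x))// ler_norm //.
- rewrite (_ : _ \o _ = (fun x => C%:E * (EFin \o window (- N) N) x)%E); last first.
    by apply/funext => x /=; rewrite EFinM.
  by apply: integrableZl => //; rewrite window_indic; exact: integrable_indic_itv.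
Qed.

Lemma tameP f (C a b : R) : measurable_fun setT f ->
  (forall x, `|f x| <= C * window a b x) -> tame f.
Proof.
move=> mf fC; split => //; exists `|C|, (Num.max `|a| `|b|) => x.
apply: (le_trans (fC x)); apply: (@le_trans _ _ (`|C| * window a b x)).
  by rewrite ler_wpM2r ?window_ge0 ?ler_norm.
rewrite ler_wpM2l// window_sub//.
  by rewrite lerNl le_max -(normrN a) ler_norm.
by rewrite le_max (ler_norm b) orbT.
Qed.

Lemma tame_window a b : tame (window a b).
Proof.
apply: (@tameP _ 1 a b); first exact: measurable_window.
by move=> x; rewrite mul1r ger0_norm// window_ge0.
Qed.

Lemma tameM g f (C : R) : measurable_fun setT g -> (forall x, `|g x| <= C) ->
  tame f -> tame (fun x => g x * f x).
Proof.
move=> mg gC [mf [D [N fD]]]; apply: (@tameP _ (C * D) (- N) N).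
  exact: measurable_funM.
by move=> x; rewrite normrM -mulrA ler_pM.
Qed.

Lemma tameZ f c : tame f -> tame (fun x => c * f x).
Proof. by apply: (@tameM (cst c) f `|c|) => //=. Qed.

Lemma tameD f g : tame f -> tame g -> tame (fun x => f x + g x).
Proof.
move=> [mf [C [N fC]]] [mg [D [M gD]]].
apply: (@tameP _ (`|C| + `|D|) (- (Num.max N M)) (Num.max N M)).
  exact: measurable_funD.
have le_mon (D1 N1 N2 x : R) : N1 <= N2 ->
    D1 * window (- N1) N1 x <= `|D1| * window (- N2) N2 x.
  move=> N12; apply: (@le_trans _ _ (`|D1| * window (- N1) N1 x)).
    by rewrite ler_wpM2r ?window_ge0 ?ler_norm.
  by rewrite ler_wpM2l// window_sub// lerN2.
move=> x; rewrite (le_trans (ler_normD _ _))// mulrDl lerD//.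
  by apply: (le_trans (fC x)); apply: le_mon; rewrite le_max lexx.
by apply: (le_trans (gD x)); apply: le_mon; rewrite le_max lexx orbT.
Qed.

Lemma tameN f : tame f -> tame (fun x => - f x).
Proof.
move=> tf; rewrite (_ : (fun x => - f x) = (fun x => -1 * f x)); first exact: tameZ.
by apply/funext => x; rewrite mulN1r.
Qed.

Lemma tameB f g : tame f -> tame g -> tame (fun x => f x - g x).
Proof. by move=> tf tg; apply: tameD => //; exact: tameN. Qed.

Lemma tame_norm f : tame f -> tame (fun x => `|f x|).
Proof.
move=> [mf [C [N fC]]]; apply: (@tameP _ C (- N) N).
  exact: measurableT_comp.
by move=> x; rewrite normr_id.
Qed.

Lemma intRD f g : tame f -> tame g ->
  intR (fun x => f x + g x) = intR f + intR g.
Proof. by move=> tf tg; apply: RintegralD => //; exact: tame_integrable. Qed.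

Lemma intRB f g : tame f -> tame g ->
  intR (fun x => f x - g x) = intR f - intR g.
Proof. by move=> tf tg; apply: RintegralB => //; exact: tame_integrable. Qed.

Lemma intRZ f c : tame f -> intR (fun x => c * f x) = c * intR f.
Proof. by move=> tf; apply: RintegralZl => //; exact: tame_integrable. Qed.

Lemma le_intR f g : tame f -> tame g -> (forall x, f x <= g x) ->
  intR f <= intR g.
Proof.
by move=> tf tg fg; apply: le_Rintegral => //; exact: tame_integrable.
Qed.

Lemma eq_intR f g : f =1 g -> intR f = intR g.
Proof. by move=> /funext ->. Qed.

Lemma le_norm_intR f g : tame f -> tame g -> (forall x, `|f x| <= g x) ->
  `|intR f| <= intR g.
Proof.
move=> tf tg fg; apply: le_trans (le_intR (tame_norm tf) tg fg).
by apply: le_normr_Rintegral => //; exact: tame_integrable.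
Qed.

(** Most error estimates below have this form, with h a combination of
windows and kernels whose integrals are known. *)
Lemma le_dist_intR f g h : tame f -> tame g -> tame h ->
  (forall x, `|f x - g x| <= h x) -> `|intR f - intR g| <= intR h.
Proof.
by move=> tf tg th fg; rewrite -intRB//; apply: le_norm_intR => //; exact: tameB.
Qed.

Lemma intR_itv f a b :
  \int[mu]_(x in `[a, b]) f x = intR (fun x => f x * window a b x).
Proof.
rewrite Rintegral_mkcond; apply: eq_Rintegral => x _.
by rewrite patchE mem_setE in_itv /= /window; case: ifP; rewrite ?mulr1 ?mulr0.
Qed.

Lemma intR_window a b : a <= b -> intR (window a b) = b - a.
Proof.
move=> ab; rewrite /intR window_indic /Rintegral integral_indic// setIT.
have := lebesgue_measure_itv `[a, b]%R; rewrite /= lte_fin => ->.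
by move: ab; rewrite le_eqVlt => /predU1P[->|->//]; rewrite ltxx subrr.
Qed.

(** Derivatives under the integral sign are obtained from this criterion:
a pointwise second-order remainder survives integration over a bounded set. *)
Lemma local_quadratic_is_derive f x (d C : R) :
  (forall h : R, `|h| <= 1 -> `|f (x + h) - f x - h * d| <= C * h ^+ 2) ->
  is_derive x 1 f d.
Proof.
move=> fC.
have H : (fun h : R => h^-1 *: (f (h *: 1 + x) - f x)) @ 0^' --> d.
  apply/cvgrPdist_le => e e0; near=> k.
  have k0 : k != 0 by near: k; exact: nbhs_dnbhs_neq.
  have k1 : `|k| <= 1 by near: k; apply: dnbhs0_le.
  rewrite /= /GRing.scale /= mulr1 (addrC k).
  rewrite -(ler_pM2l (_ : 0 < `|k|)) ?normr_gt0// -normrM.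
  rewrite mulrBr mulrA divff// mul1r distrC (le_trans (fC k k1))//.
  rewrite -(real_normK (num_real k)) expr2 mulrCA.
  rewrite ler_wpM2l//.
  rewrite (@le_trans _ _ ((`|C| + 1) * `|k|))//.
    by rewrite ler_wpM2r// (le_trans (ler_norm _))// lerDl.
  rewrite mulrC -ler_pdivlMr; last by rewrite ltr_pwDr.
  by near: k; apply: dnbhs0_le; rewrite divr_gt0// ltr_pwDr.
by apply: DeriveDef; [apply/cvg_ex; exists d|exact/cvg_lim].
Unshelve. all: by end_near. Qed.

Lemma quadratic_is_derive f x (d C : R) :
  (forall h : R, `|f (x + h) - f x - h * d| <= C * h ^+ 2) -> is_derive x 1 f d.
Proof. by move=> fC; apply: local_quadratic_is_derive => h _; exact: fC. Qed.

Lemma lipschitz_continuous f (C : R) :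
  (forall x y, `|f x - f y| <= C * `|x - y|) -> continuous f.
Proof.
move=> fC x; apply/cvgrPdist_le => e e0; near=> y.
apply: (le_trans (fC x y)); rewrite (@le_trans _ _ ((`|C| + 1) * `|x - y|))//.
  by rewrite ler_wpM2r// (le_trans (ler_norm _))// lerDl.
rewrite mulrC -ler_pdivlMr; last by rewrite ltr_pwDr.
by near: y; apply: cvgr_dist_le => //; rewrite divr_gt0// ltr_pwDr.
Unshelve. all: by end_near. Qed.

Lemma is_derive1_continuous f x (d : R) : is_derive x 1 f d -> {for x, continuous f}.
Proof.
by move=> [df _]; apply: differentiable_continuous; apply/derivable1_diffP.
Qed.

Lemma ftc2_intR f F a b : a < b -> continuous f ->
  (forall x, is_derive x 1 F (f x)) ->
  intR (fun x => f x * window a b x) = F b - F a.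
Proof.
move=> ab cf dF; rewrite -intR_itv /Rintegral (@continuous_FTC2 _ f F)//.
- exact: continuous_subspaceT.
- have cF x : {for x, continuous F} by exact: is_derive1_continuous (dF x).
  split; first by move=> x _; have [] := dF x.
  + exact: cvg_at_right_filter (cF a).
  + exact: cvg_at_left_filter (cF b).
- by move=> x _; rewrite derive1E; have [_ ->] := dF x.
Qed.

(** The parametrized integral is differentiable only to the right of its
base point; near each x the two one-sided integrals from 0 differ by a constant
from the integral based at a point u to the left of both x and 0. *)
Lemma primitive_exists f : continuous f ->
  exists F : R -> R, forall x, is_derive x 1 F (f x).
Proof.
move=> cf.
have itf (u w : R) : mu.-integrable `[u, w] (EFin \o f).
  by apply: continuous_compact_integrable; [exact: segment_compact|exact: continuous_subspaceT].
exists (fun x => \int[mu]_(t in `[0, x]) f t - \int[mu]_(t in `[x, 0]) f t) => x.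
(* A common base point to the left of x and 0. *)
pose u := - `|x| - 1.
have ux : u < x by rewrite /u; have := ler_norm (- x); rewrite normrN; lra.
have u0 : u < 0 by rewrite /u; have := normr_ge0 x; lra.
have x1 : x < x + 1 by rewrite ltrDl.
have [dx Dx] := continuous_FTC1_closed x1 (itf u (x + 1)) ux (cf x).
have dFu : is_derive x 1 (fun y => \int[mu]_(t in `[u, y]) f t) (f x).
  by apply: DeriveDef; [exact: dx|rewrite -derive1E; exact: Dx].
apply: (@near_eq_is_derive _ _ _
  (fun y => \int[mu]_(t in `[u, y]) f t - \int[mu]_(t in `[u, 0]) f t)).
  near=> y.
  have uy : u < y by near: y; exact: lt_nbhsr.
  have E (p q : R) : u < p -> p <= q ->
      \int[mu]_(t in `[u, q]) f t - \int[mu]_(t in `[u, p]) f t = \int[mu]_(t in `[p, q]) f t.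
    move=> up pq; rewrite Rintegral_itvB ?bnd_simp ?(ltW up)//.
    by rewrite Rintegral_itv_obnd_cbnd//; apply: integrableS (itf p q) => //; exact: subset_itv_oc_cc.
  have [y0|y0] := leP 0 y.
    rewrite E//; have [->|yn0] := eqVneq y 0; first by rewrite subrr set_itv1 Rintegral_set1.
    rewrite [X in _ - X](_ : _ = 0) ?subr0//.
    by rewrite set_itv_ge ?Rintegral_set0// bnd_simp -ltNge lt_neqAle eq_sym yn0.
  rewrite -opprB E ?(ltW y0)// [X in X - _](_ : _ = 0) ?sub0r//.
  by rewrite set_itv_ge ?Rintegral_set0// bnd_simp -ltNge.
by apply: is_derive_eq; rewrite subr0.
Unshelve. all: by end_near. Qed.
End tame_functions.

(** * A tent kernel and its primitive *)

Section mollifier.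
Context {R : realType}.
Implicit Types (e x y z h : R).

Definition pos z : R := Num.max 0 z.

(** The tent of height 1 / e on [0, 2 e], written as a second difference of
the positive part so that ramp, its primitive, is again explicit. *)
Definition bump e z : R := (pos z - 2 * pos (z - e) + pos (z - 2 * e)) / e ^+ 2.

(** A C^1 step from 0 to 1 across [0, 2 e]. *)
Definition ramp e z : R :=
  (pos z ^+ 2 - 2 * pos (z - e) ^+ 2 + pos (z - 2 * e) ^+ 2) / (2 * e ^+ 2).

Lemma pos_ge0 z : 0 <= pos z. Proof. by rewrite /pos le_max lexx. Qed.

Lemma pos_lip x y : `|pos x - pos y| <= `|x - y|.
Proof.
have := ler_norm (x - y); have := ler_norm (y - x); rewrite (distrC y).
by rewrite /pos ler_norml; case: (leP 0 x) => ?; case: (leP 0 y) => ?; lra.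
Qed.

Lemma pos_sqr_taylor x h :
  `|pos (x + h) ^+ 2 - pos x ^+ 2 - h * (2 * pos x)| <= h ^+ 2.
Proof.
rewrite /pos; case: (leP 0 x) => x0; case: (leP 0 (x + h)) => xh0;
  rewrite ler_norml; apply/andP; split; nra.
Qed.

Lemma pos_sqr_derive x : is_derive x 1 (fun z => pos z ^+ 2) (2 * pos x).
Proof.
by apply: (@quadratic_is_derive _ _ _ _ 1) => h; rewrite mul1r pos_sqr_taylor.
Qed.

Variable e : R.
Hypothesis e0 : 0 < e.

Let e20 : 0 < e ^+ 2. Proof. exact: exprn_gt0. Qed.

Lemma bump_ge0 z : 0 <= bump e z.
Proof.
rewrite /bump divr_ge0 ?sqr_ge0// /pos.
case: (leP 0 z) => ?; case: (leP 0 (z - e)) => ?; case: (leP 0 (z - 2 * e)) => ?; move: e0 => ?; lra.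
Qed.

Lemma bump_out z : ~~ (0 <= z <= 2 * e) -> bump e z = 0.
Proof.
rewrite /bump /pos => H; apply/eqP; rewrite mulf_eq0; apply/orP; left; apply/eqP; move: H.
case: (leP 0 z) => ?; case: (leP 0 (z - e)) => ?; case: (leP 0 (z - 2 * e)) => ?; move: e0 => ? /negP H;
 try lra; exfalso; apply: H; lra.
Qed.

Lemma bump_lip x y : `|bump e x - bump e y| <= 4 / e ^+ 2 * `|x - y|.
Proof.
rewrite /bump -mulrBl normrM mulrAC [`|_^-1|]ger0_norm ?invr_ge0 ?sqr_ge0//.
rewrite ler_wpM2r ?invr_ge0 ?sqr_ge0//.
have := pos_lip x y; have := pos_lip (x - e) (y - e).
have := pos_lip (x - 2 * e) (y - 2 * e).
rewrite (_ : x - 2 * e - _ = x - y); last by ring.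
rewrite (_ : x - e - _ = x - y); last by ring.
by rewrite !ler_norml; lra.
Qed.

Lemma ramp_taylor x h :
  `|ramp e (x + h) - ramp e x - h * bump e x| <= 2 / e ^+ 2 * h ^+ 2.
Proof.
have := pos_sqr_taylor x h; have := pos_sqr_taylor (x - e) h.
have := pos_sqr_taylor (x - 2 * e) h.
rewrite !(addrAC x _ h) /ramp /bump.
set a := pos (x + h); set b := pos (x + h - e); set c := pos (x + h - 2 * e).
set a' := pos x; set b' := pos (x - e); set c' := pos (x - 2 * e) => H1 H2 H3.
rewrite (_ : _ - _ = (e ^+ 2)^-1 * ((a ^+ 2 - a' ^+ 2 - h * (2 * a'))
  - 2 * (b ^+ 2 - b' ^+ 2 - h * (2 * b'))
  + (c ^+ 2 - c' ^+ 2 - h * (2 * c'))) / 2); last by field; rewrite gt_eqF.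
rewrite -mulrA normrM ger0_norm ?invr_ge0 ?sqr_ge0//.
rewrite [X in _ <= X](_ : _ = (e ^+ 2)^-1 * (2 * h ^+ 2)); last by ring.
rewrite ler_wpM2l ?invr_ge0 ?sqr_ge0// normrM [`|2^-1|]ger0_norm ?invr_ge0//.
rewrite ler_pdivrMr//.
by move: H1 H2 H3; rewrite !ler_norml; lra.
Qed.

Lemma ramp_derive x : is_derive x 1 (ramp e) (bump e x).
Proof. exact: (quadratic_is_derive (ramp_taylor x)). Qed.

Lemma ramp_left z : z <= 0 -> ramp e z = 0.
Proof.
move=> z0; rewrite /ramp /pos !max_l ?expr0n/= ?mulr0 ?subrr ?addr0 ?mul0r//;
 move: e0; lra.
Qed.

Lemma ramp_right z : 2 * e <= z -> ramp e z = 1.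
Proof.
move=> z0; rewrite /ramp /pos !max_r; try (move: e0; lra).
by field; rewrite gt_eqF.
Qed.

Lemma ramp_nd x y : x <= y -> ramp e x <= ramp e y.
Proof.
move=> xy; have [||c _] := @MVT_segment _ (ramp e) (bump e) x y xy.
- by move=> z _; exact: ramp_derive.
- by apply: continuous_subspaceT => z; exact: is_derive1_continuous (ramp_derive z).
- by move=> H; rewrite -subr_ge0 H mulr_ge0 ?bump_ge0// subr_ge0.
Qed.

Lemma ramp_ge0 z : 0 <= ramp e z.
Proof.
have [z0|/ltW z0] := leP z 0; first by rewrite ramp_left.
by rewrite -(ramp_left (lexx 0)) ramp_nd.
Qed.

Lemma ramp_le1 z : ramp e z <= 1.
Proof.
have [z0|/ltW z0] := leP (2 * e) z; first by rewrite ramp_right.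
by rewrite -(ramp_right (lexx _)) ramp_nd.
Qed.

Lemma bump_window c x : bump e (x - c) = bump e (x - c) * window c (c + 2 * e) x.
Proof.
case: (boolP (c <= x <= c + 2 * e)) => H; first by rewrite window_in// mulr1.
rewrite (@window_out _ _ _ _ H) mulr0 bump_out//; apply: contra H => /andP[]; lra.
Qed.

Lemma bump_le z : bump e z <= e^-1.
Proof.
rewrite /bump ler_pdivrMr// expr2 mulKf ?gt_eqF// /pos.
case: (leP 0 z) => ?; case: (leP 0 (z - e)) => ?; case: (leP 0 (z - 2 * e)) => ?; move: e0 => ?; lra.
Qed.

Lemma continuous_bump_shift c : continuous (fun x => bump e (x - c)).
Proof.
apply: (@lipschitz_continuous _ _ (4 / e ^+ 2)) => x y.
by apply: (le_trans (bump_lip _ _)); rewrite (_ : x - c - _ = x - y)//; ring.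
Qed.

Lemma tame_bump c : tame (fun x => bump e (x - c)).
Proof.
apply: (@tameP _ _ e^-1 c (c + 2 * e)).
  exact: continuous_measurable_fun (@continuous_bump_shift c).
move=> x; rewrite bump_window normrM ger0_norm ?bump_ge0// ger0_norm ?window_ge0//.
by rewrite ler_wpM2r ?window_ge0// bump_le.
Qed.

Lemma intR_bump c : intR (fun x => bump e (x - c)) = 1.
Proof.
have dr x : is_derive x 1 (fun x => ramp e (x - c)) (bump e (x - c)).
  apply: (@quadratic_is_derive _ _ _ _ (2 / e ^+ 2)) => h.
  by rewrite (addrAC x h) ramp_taylor.
have ltc : c < c + 2 * e by rewrite ltrDl mulr_gt0.
rewrite (eq_intR (bump_window c)) (ftc2_intR ltc (@continuous_bump_shift c) dr).
rewrite (_ : c + 2 * e - c = 2 * e); last by ring.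
by rewrite subrr ramp_right// ramp_left// subr0.
Qed.
End mollifier.

(** * Derivatives at a maximum, and a decaying weight *)

Section calculus.
Context {R : realType}.
Implicit Types (f : R -> R) (x y d : R).

(** The barrier may be maximal at the final time, where only earlier times
can be compared. *)
Lemma is_derive_left_max f x d (r : R) : 0 < r -> is_derive x 1 f d ->
  (forall y, x - r < y < x -> f y <= f x) -> 0 <= d.
Proof.
move=> r0 [dfx dfE] fmax; rewrite leNgt; apply/negP => d0.
have cv : (fun h : R => h^-1 *: (f (h *: 1 + x) - f x)) @ 0^' --> d.
  by rewrite -dfE.
have : \forall h \near 0^', h^-1 *: (f (h *: 1 + x) - f x) < (0 : R).
  exact: cvgr_lt cv _ d0.
move=> [e /= e0 He].
(* A step to the left, short enough for both neighbourhoods. *)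
pose h := - (Num.min e r / 2).
have m0 : 0 < Num.min e r by rewrite lt_min e0 r0.
have h0 : h < 0 by rewrite oppr_lt0 divr_gt0.
have := He h; rewrite /= sub0r normrN ltr0_norm// opprK.
have me : Num.min e r <= e by rewrite ge_min lexx.
have mr : Num.min e r <= r by rewrite ge_min lexx orbT.
have hr : x - r < h + x < x by rewrite /h; apply/andP; split; lra.
have he : Num.min e r / 2 < e by lra.
move=> /(_ he (ltr0_neq0 h0)).
apply/negP; rewrite -leNgt /GRing.scale /= mulr1 mulr_le0 ?subr_le0 ?fmax//.
by rewrite invr_le0 ltW.
Qed.

Lemma is_derive_global_max f x (df : R -> R) :
  (forall y, is_derive y 1 f (df y)) -> (forall y, f y <= f x) -> df x = 0.
Proof.
move=> fd fmax.
have d0 : is_derive x 1 f 0.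
  apply: (@derive1_at_max _ f (x - 1) (x + 1)).
  - by lra.
  - by move=> t _; have [] := fd t.
  - by rewrite in_itv/=; lra.
  - by move=> t _; exact: fmax.
by have [_ <-] := fd x; have [_ ->] := d0.
Qed.

Lemma le_is_derive f (df : R -> R) (C a b : R) : a <= b ->
  (forall x, a < x < b -> is_derive x 1 f (df x)) ->
  {within `[a, b], continuous f} ->
  (forall x, a < x < b -> df x <= C) -> f b - f a <= C * (b - a).
Proof.
rewrite le_eqVlt => /predU1P[<- *|ab fd cf dfC]; first by rewrite !subrr mulr0.
have fd' x : x \in `]a, b[ -> is_derive x 1 f (df x) by rewrite in_itv; exact: fd.
have [c cab ->] := MVT ab fd' cf.
by rewrite ler_wpM2r ?subr_ge0 ?(ltW ab)// dfC//; move: cab; rewrite in_itv.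
Qed.

Lemma le_norm_is_derive f (df : R -> R) (C a b : R) : a <= b ->
  (forall x, a < x < b -> is_derive x 1 f (df x)) ->
  {within `[a, b], continuous f} ->
  (forall x, a < x < b -> `|df x| <= C) -> `|f b - f a| <= C * (b - a).
Proof.
rewrite le_eqVlt => /predU1P[<- *|ab fd cf dfC]; first by rewrite !subrr normr0 mulr0.
have fd' x : x \in `]a, b[ -> is_derive x 1 f (df x) by rewrite in_itv; exact: fd.
have [c cab ->] := MVT ab fd' cf.
rewrite normrM (ger0_norm (_ : 0 <= b - a)) ?subr_ge0 ?(ltW ab)//.
by rewrite ler_wpM2r ?subr_ge0 ?(ltW ab)// dfC//; move: cab; rewrite in_itv.
Qed.

Lemma near_small (C k : R) : 0 < k -> \forall e \near 0^'+, C * e <= k.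
Proof.
move=> k0; near=> e.
have e0 : 0 < e by near: e; exact: nbhs_right_gt.
apply: (@le_trans _ _ ((`|C| + 1) * e)).
  by rewrite ler_wpM2r ?(ltW e0)// (le_trans (ler_norm _))// lerDl.
rewrite mulrC -ler_pdivlMr; last by rewrite ltr_pwDr.
by near: e; apply: nbhs_right_le; rewrite divr_gt0// ltr_pwDr.
Unshelve. all: by end_near. Qed.
End calculus.

Section weight.
Context {R : realType}.
Implicit Types (y eta : R).

(** The barrier function grows at most like the fourth power of y; this
weight makes it vanish at infinity, while a shift of the argument by eta and a
differentiation only cost constant factors. *)
Definition weight y : R := (1 + y ^+ 2) ^- 3.

Definition weight' y : R := - (6 * y) / (1 + y ^+ 2) ^+ 4.

Let s1 y : 1 <= 1 + y ^+ 2. Proof. by rewrite lerDl sqr_ge0. Qed.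
Let s0 y : 0 < 1 + y ^+ 2. Proof. exact: lt_le_trans (s1 y). Qed.

Lemma weight_gt0 y : 0 < weight y.
Proof. by rewrite invr_gt0 exprn_gt0. Qed.

Lemma weight_is_derive y : is_derive y 1 weight (weight' y).
Proof.
have d : is_derive y 1 ((cst 1 + (@id R) ^+ 2) ^+ 3) (6 * y * (1 + y ^+ 2) ^+ 2).
  by apply: is_derive_eq; rewrite /GRing.scale /= !fctE; ring.
rewrite (_ : weight = (fun z => (((cst 1 + (@id R) ^+ 2) ^+ 3) z)^-1)); last first.
  by apply/funext => z; rewrite /weight !fctE.
have H : ((cst 1 + (@id R) ^+ 2) ^+ 3) y != 0 by rewrite !fctE expf_neq0 ?gt_eqF.
have dV := @is_deriveV _ _ _ _ _ H d.
rewrite (_ : weight' y = - (((cst 1 + (@id R) ^+ 2) ^+ 3) y) ^- 2 *: (6 * y * (1 + y ^+ 2) ^+ 2))//.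
rewrite /weight' /GRing.scale /= !fctE.
by field; rewrite gt_eqF.
Qed.

Lemma weight'_le y : `|weight' y| <= 3 * weight y.
Proof.
have -> : weight' y = (- (6 * y) / (1 + y ^+ 2)) * weight y.
  by rewrite /weight' /weight; field; rewrite gt_eqF.
rewrite normrM (ger0_norm (ltW (weight_gt0 y))) ler_wpM2r ?(ltW (weight_gt0 y))//.
rewrite normrM normfV (ger0_norm (ltW (s0 y))) ler_pdivrMr// normrN.
have := sqr_ge0 (y - 1); have := sqr_ge0 (y + 1).
by rewrite ler_norml sqrrB1 sqrrD1; lra.
Qed.

Lemma weight_growth y : (1 + `|y|) ^+ 4 * weight y <= 4 / (1 + y ^+ 2).
Proof.
rewrite /weight ler_pdivrMr ?exprn_gt0//.
rewrite [leRHS](_ : _ = (2 * (1 + y ^+ 2)) ^+ 2); last by field; rewrite gt_eqF.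
rewrite (_ : _ ^+ 4 = ((1 + `|y|) ^+ 2) ^+ 2); last by ring.
rewrite lerXn2r ?nnegrE ?sqr_ge0 ?mulr_ge0 ?(ltW (s0 y))//.
rewrite -[y ^+ 2]real_normK ?num_real//.
by have := sqr_ge0 (`|y| - 1); rewrite sqrrB1 sqrrD; lra.
Qed.

Lemma weight_cube y : (1 + `|y|) ^+ 3 * weight y <= 4.
Proof.
apply: (@le_trans _ _ ((1 + `|y|) ^+ 4 * weight y)).
  rewrite ler_wpM2r ?(ltW (weight_gt0 y))// [leRHS]exprS.
  by rewrite ler_peMl ?exprn_ge0 ?addr_ge0// lerDl.
apply: (le_trans (weight_growth y)).
by rewrite ler_pdivrMr// ler_peMr.
Qed.

Lemma weight_square y : (1 + `|y|) ^+ 2 * weight y <= 4.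
Proof.
apply: le_trans (weight_cube y).
rewrite ler_wpM2r ?(ltW (weight_gt0 y))// [leRHS]exprS.
by rewrite ler_peMl ?exprn_ge0 ?addr_ge0// lerDl.
Qed.

Lemma weight_shift eta y :
  weight y <= (2 * (1 + eta ^+ 2)) ^+ 3 * weight (y + eta).
Proof.
rewrite /weight ler_pdivlMr ?exprn_gt0// mulrC ler_pdivrMr ?exprn_gt0// -exprMn.
by rewrite lerXn2r ?nnegrE ?(ltW (s0 _)) ?mulr_ge0 ?(ltW (s0 _))//; nra.
Qed.
Lemma weight_nonincreasing (y z : R) : 0 <= y <= z -> weight z <= weight y.
Proof.
move=> /andP[y0 yz]; rewrite /weight lef_pV2 ?posrE ?exprn_gt0 ?ltr_wpDr ?sqr_ge0//.
by rewrite lerXn2r ?nnegrE ?addr_ge0 ?sqr_ge0// lerD2l lerXn2r ?nnegrE ?(le_trans y0).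
Qed.
End weight.

(** * Algebra at the maximum of the barrier function *)

Ltac nonneg := solve [repeat first
  [done | exact: sqr_ge0 | exact: normr_ge0 | exact: ltW | apply: mulr_ge0 | apply: addr_ge0]].

Section barrier.
Context {R : realType}.

(** The contradiction at a positive maximum of
exp(-K t) m^2 D^2 weight - delta (1 + t).  Here M, d, d1 stand for m(y), D(y)
and D(y + eta), w and w' for the weight and its derivative, X for exp(-K t).
Adding c times the equation for the y-derivative to the inequality for the
t-derivative produces the transport operator; the source term
-2 a M^2 d w c is controlled by d^2 + d1^2, and the maximality at y bounds the
d1 part by S times the value of the maximum. *)
Lemma barrier_contradiction
    (C a eps X M d d1 w w' c mt my S G delta : R) :
  1 <= C -> 0 <= a <= C -> 0 < eps -> 0 < X <= 1 -> 0 <= M -> 0 <= w ->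
  `|w'| <= 3 * w -> `|mt + c * my| <= C * eps -> `|c| <= C ->
  `|c| <= C * (`|d1| + `|d|) + C * eps ->
  M * d ^+ 2 * w <= G -> M ^+ 2 * `|d| * w <= G ->
  X * (M ^+ 2 * d1 ^+ 2 * w) <= S * (X * (M ^+ 2 * d ^+ 2 * w)) ->
  0 <= X * w * (2 * M * d ^+ 2 * mt + 2 * M ^+ 2 * d * mt)
       - (3 * C + 3 * C ^+ 2 + C ^+ 2 * S) * (X * (M ^+ 2 * d ^+ 2 * w)) - delta ->
  2 * M * my * d ^+ 2 * w + 2 * M ^+ 2 * d * (my - a) * w + M ^+ 2 * d ^+ 2 * w' = 0 ->
  (4 * C + 2 * C ^+ 2) * G * eps < delta -> False.
Proof.
move=> C1 /andP[a0 aC] eps0 /andP[X0 X1] M0 w0 hw' htr hc hcl hG1 hG2 hsh ht hy hdelta.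
have C0 : 0 <= C by lra.
pose p := M ^+ 2 * d ^+ 2 * w.
pose q := M ^+ 2 * d1 ^+ 2 * w.
pose u := M ^+ 2 * `|d| * w.
have u0 : 0 <= u by nonneg.
have p0 : 0 <= p by nonneg.
have G0 : 0 <= G by exact: le_trans hG2.
pose T1 := w * (2 * M * d ^+ 2 + 2 * M ^+ 2 * d) * (mt + c * my).
pose T2 := - (2 * a * M ^+ 2 * d * w * c).
pose T3 := c * (M ^+ 2 * d ^+ 2) * w'.
have T1le : T1 <= 4 * G * (C * eps).
  apply: le_trans (ler_norm _) _; rewrite /T1 normrM ler_pM//.
  rewrite normrM (ger0_norm w0).
  apply: (@le_trans _ _ (w * (2 * M * d ^+ 2 + 2 * M ^+ 2 * `|d|))).
    rewrite ler_wpM2l// (le_trans (ler_normD _ _))//.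
    rewrite (@ger0_norm _ (2 * M * d ^+ 2)); last by nonneg.
    by rewrite normrM (@ger0_norm _ (2 * M ^+ 2)) //; nonneg.
  rewrite -/u in hG2 *.
  rewrite (_ : w * _ = 2 * (M * d ^+ 2 * w) + 2 * u); last by rewrite /u; ring.
  by lra.
have T2le : T2 <= C ^+ 2 * (p + q) + 2 * C ^+ 2 * p + 2 * C ^+ 2 * G * eps.
  have cu : `|c| * u <= (C * (`|d1| + `|d|) + C * eps) * u by rewrite ler_wpM2r.
  have T2u : T2 <= 2 * C * (`|c| * u).
    apply: le_trans (ler_norm _) _.
    rewrite /T2 (_ : - _ = - (2 * a * M ^+ 2 * w) * (d * c)); last by ring.
    rewrite normrM normrN (@ger0_norm _ (2 * a * _ * _)) ?normrM; last by nonneg.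
    rewrite (_ : _ * (`|d| * `|c|) = 2 * a * (`|c| * u)); last by rewrite /u; ring.
    by rewrite ler_wpM2r ?mulr_ge0//; lra.
  apply: (le_trans T2u).
  apply: (@le_trans _ _ (2 * C * ((C * (`|d1| + `|d|) + C * eps) * u))).
    by rewrite ler_wpM2l ?mulr_ge0.
  have upq : 2 * (`|d1| * u) <= p + q.
    rewrite -subr_ge0 (_ : _ - _ = M ^+ 2 * w * (`|d| - `|d1|) ^+ 2).
      by nonneg.
    rewrite /p /q /u -(real_normK (num_real d)) -(real_normK (num_real d1)).
    by ring.
  have up : `|d| * u = p.
    by rewrite /p /u -(real_normK (num_real d)); ring.
  rewrite (_ : 2 * C * _ = C ^+ 2 * (2 * (`|d1| * u)) + 2 * C ^+ 2 * (`|d| * u)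
     + 2 * C ^+ 2 * eps * u); last by ring.
  rewrite up lerD// ?lerD// ?ler_wpM2l ?sqr_ge0//.
  rewrite (_ : 2 * C ^+ 2 * G * eps = 2 * C ^+ 2 * eps * G); last by ring.
  by rewrite ler_wpM2l//; nonneg.
have T3le : T3 <= 3 * C * p.
  apply: le_trans (ler_norm _) _.
  rewrite /T3 !(normrM _ w') (normrM c) (@ger0_norm _ (M ^+ 2 * d ^+ 2)); last by nonneg.
  rewrite (_ : 3 * C * p = C * (M ^+ 2 * d ^+ 2) * (3 * w)); last by rewrite /p; ring.
  have Md : 0 <= M ^+ 2 * d ^+ 2 by nonneg.
  by apply: ler_pM => //; [nonneg|exact: ler_wpM2r].
have E : 0 <= X * (T1 + T2 + T3)
    - (3 * C + 3 * C ^+ 2 + C ^+ 2 * S) * (X * p) - delta.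
  apply: (le_trans ht); rewrite -[leLHS]addr0 -(mulr0 (X * c)) -hy /T1 /T2 /T3 /p.
  by rewrite le_eqVlt; apply/orP; left; apply/eqP; ring.
have XT : X * (T1 + T2 + T3) <= X * (4 * G * (C * eps)
    + (C ^+ 2 * (p + q) + 2 * C ^+ 2 * p + 2 * C ^+ 2 * G * eps) + 3 * C * p).
  by rewrite ler_wpM2l ?(ltW X0)// lerD// lerD.
have Xe : X * ((4 * C + 2 * C ^+ 2) * G * eps) <= (4 * C + 2 * C ^+ 2) * G * eps.
  by rewrite ler_piMl//; nonneg.
have Xq : C ^+ 2 * (X * q) <= C ^+ 2 * (S * (X * p)) by rewrite ler_wpM2l ?sqr_ge0.
have : X * (4 * G * (C * eps)
    + (C ^+ 2 * (p + q) + 2 * C ^+ 2 * p + 2 * C ^+ 2 * G * eps) + 3 * C * p) =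
  X * ((4 * C + 2 * C ^+ 2) * G * eps) + C ^+ 2 * (X * q) +
  (3 * C + 3 * C ^+ 2) * (X * p) by ring.
have : (3 * C + 3 * C ^+ 2 + C ^+ 2 * S) * (X * p) =
  (3 * C + 3 * C ^+ 2) * (X * p) + C ^+ 2 * (S * (X * p)) by ring.
by lra.
Qed.
End barrier.

(** * A maximum principle for nearly transported mass *)

Section front_rigidity.
Context {R : realType}.

(** The exponential rate that absorbs the drift of the weight (3 C), the
local part of the source (3 C^2), and its look-ahead part, which carries the
factor lost by shifting the weight. *)
Definition barrier_rate (C eta : R) : R :=
  3 * C + 3 * C ^+ 2 + C ^+ 2 * (2 * (1 + eta ^+ 2)) ^+ 3.

Definition barrier_const (T C eta : R) : R :=
  expR (barrier_rate C eta * T) * (1 + T) * (100 * C ^+ 5).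

Variables (T C a eta eps : R) (m mt my c : R -> R -> R).
Implicit Types t s y z : R.
Let D t y := m t y - a * y.
Hypothesis T0 : 0 <= T.
Hypothesis C1 : 1 <= C.
Hypothesis aC : 0 <= a <= C.
Hypothesis eta0 : 0 <= eta.
Hypothesis eps0 : 0 < eps.
Hypothesis eps1 : eps <= 1.
Hypothesis m_t : forall t y : R, 0 < t -> is_derive t 1 (m ^~ y) (mt t y).
Hypothesis m_y : forall t y : R, 0 <= t -> is_derive y 1 (m t) (my t y).
Hypothesis m_lip : forall s t y z : R, 0 <= s -> 0 <= t ->
  `|m s y - m t z| <= C * (`|s - t| + `|y - z|).
Hypothesis m_growth : forall t y : R, 0 <= t <= T -> `|m t y| <= C * (1 + `|y|).
Hypothesis my_ge0 : forall t y : R, 0 <= t <= T -> 0 <= my t y.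
Hypothesis transport : forall t y : R, 0 < t <= T -> `|mt t y + c t y * my t y| <= C * eps.
Hypothesis c_le : forall t y : R, 0 <= t <= T -> `|c t y| <= C.
Hypothesis c_local : forall t y : R, 0 <= t <= T ->
  `|c t y| <= C * (`|D t (y + eta)| + `|D t y|) + C * eps.
Hypothesis initially : forall y : R, m 0 y <= 0 \/ `|D 0 y| <= C * eps.

Let S : R := (2 * (1 + eta ^+ 2)) ^+ 3.
Let K : R := barrier_rate C eta.
Let delta : R := 100 * C ^+ 5 * eps.

Let P t y := pos (m t y) ^+ 2 * D t y ^+ 2 * weight y.
Let Q t y := expR (- K * t) * P t y - delta * (1 + t).

Let C0 : 0 <= C. Proof. exact: le_trans C1. Qed.

Let S_ge0 : 0 <= S.
Proof. by rewrite /S exprn_ge0// mulr_ge0// addr_ge0 ?sqr_ge0. Qed.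

Let K_ge0 : 0 <= K.
Proof. rewrite /K /barrier_rate -/S; nonneg. Qed.

Let delta_gt0 : 0 < delta.
Proof. by rewrite /delta !mulr_gt0 ?exprn_gt0 ?(lt_le_trans ltr01 C1). Qed.

Let D_growth t y : 0 <= t <= T -> `|D t y| <= 2 * C * (1 + `|y|).
Proof.
move=> tT; rewrite /D (le_trans (ler_normB _ _))// normrM.
move/andP: aC => [a0 aC']; rewrite (ger0_norm a0).
have := m_growth y tT; have : a * `|y| <= C * `|y| by rewrite ler_wpM2r.
by move: C1; lra.
Qed.

Let pos_growth t y : 0 <= t <= T -> pos (m t y) <= C * (1 + `|y|).
Proof.
move=> tT; apply: le_trans (m_growth y tT).
by rewrite /pos ge_max normr_ge0 ler_norm.
Qed.

Let m_nd t y z : 0 <= t <= T -> y <= z -> m t y <= m t z.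
Proof.
move=> /andP[t0 tT] yz.
have cm : {within `[y, z], continuous (m t)}.
  by apply: continuous_subspaceT => x; exact: is_derive1_continuous (m_y x t0).
have dm x : x \in `]y, z[ -> is_derive x 1 (m t) (my t x) by move=> _; exact: m_y.
have [x _ H] := MVT_segment yz dm cm.
by rewrite -subr_ge0 H mulr_ge0 ?subr_ge0// my_ge0 ?t0.
Qed.

Let P_decay t y : 0 <= t <= T -> P t y <= 16 * C ^+ 4 / (1 + y ^+ 2).
Proof.
move=> tT; rewrite /P.
apply: (@le_trans _ _ (4 * C ^+ 4 * ((1 + `|y|) ^+ 4 * weight y))).
  rewrite [leRHS]mulrA ler_wpM2r ?(ltW (weight_gt0 y))//.
  rewrite (_ : 4 * _ * _ = (C * (1 + `|y|)) ^+ 2 * (2 * C * (1 + `|y|)) ^+ 2); last by ring.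
  rewrite ler_pM ?sqr_ge0//.
    by rewrite lerXn2r ?nnegrE ?pos_ge0 ?pos_growth// mulr_ge0 ?addr_ge0.
  rewrite -(real_normK (num_real (D t y))) lerXn2r ?nnegrE ?D_growth//.
  by nonneg.
rewrite (_ : 16 * _ / _ = 4 * C ^+ 4 * (4 / (1 + y ^+ 2))); last by field; rewrite gt_eqF// (lt_le_trans ltr01)// lerDl sqr_ge0.
by rewrite ler_wpM2l ?weight_growth// mulr_ge0 ?exprn_ge0.
Qed.

Let Q_initial y : Q 0 y <= 0.
Proof.
have tT : (0 : R) <= 0 <= T by rewrite lexx T0.
rewrite /Q mulr0 expR0 mul1r addr0 mulr1 subr_le0 /P.
have [m0|DC] := initially y.
  by rewrite /pos max_l// expr0n/= !mul0r ltW.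
apply: (@le_trans _ _ ((C * (1 + `|y|)) ^+ 2 * (C * eps) ^+ 2 * weight y)).
  rewrite ler_wpM2r ?(ltW (weight_gt0 y))// ler_pM ?sqr_ge0//.
    by rewrite lerXn2r ?nnegrE ?pos_ge0 ?pos_growth// mulr_ge0 ?addr_ge0.
  rewrite -(real_normK (num_real (D 0 y))) lerXn2r ?nnegrE//.
  by nonneg.
rewrite (_ : _ * weight y = C ^+ 4 * eps ^+ 2 * ((1 + `|y|) ^+ 2 * weight y)); last by ring.
apply: (@le_trans _ _ (C ^+ 4 * eps ^+ 2 * 4)).
  by rewrite ler_wpM2l ?weight_square// mulr_ge0 ?exprn_ge0 ?sqr_ge0// ltW.
have e2 : eps ^+ 2 <= eps by rewrite expr2 ler_piMr// ltW.
have C45 : C ^+ 4 <= C ^+ 5 by rewrite [leRHS]exprS ler_peMl ?exprn_ge0.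
rewrite /delta (_ : _ * 4 = 4 * (C ^+ 4 * eps ^+ 2)); last by ring.
rewrite -mulrA ler_pM ?mulr_ge0 ?exprn_ge0 ?sqr_ge0 ?ler_nat// ?(ltW eps0)//.
by rewrite ler_pM ?exprn_ge0 ?sqr_ge0// ltW.
Qed.

Let Q_continuous : continuous (fun z : R * R => Q (pos z.1) z.2).
Proof.
have cp : continuous (fun z : R * R => pos z.1).
  move=> z; apply: (@continuous_comp _ _ _ fst (@pos R)); first exact: cvg_fst.
  by apply: (@lipschitz_continuous _ _ 1) => x y; rewrite mul1r pos_lip.
have c2 : continuous (fun z : R * R => z.2) by move=> z; exact: cvg_snd.
have cm : continuous (fun z : R * R => m (pos z.1) z.2).
  move=> z; apply/cvgrPdist_le => e e0.
  have Cp : 0 < C by exact: lt_le_trans C1.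
  have He : 0 < e / (2 * C) by rewrite divr_gt0// mulr_gt0.
  near=> w.
  apply: (le_trans (m_lip _ _ (pos_ge0 _) (pos_ge0 _))).
  rewrite mulrC -ler_pdivlMr//.
  have -> : e / C = e / (2 * C) + e / (2 * C) by field; rewrite gt_eqF.
  by apply: lerD; near: w; [move/cvgrPdist_le: (cp z); exact|move/cvgrPdist_le: (c2 z); exact].
have cpm : continuous (fun z : R * R => pos (m (pos z.1) z.2)).
  move=> z; apply: (@continuous_comp _ _ _ _ (@pos R)); first exact: cm.
  by apply: (@lipschitz_continuous _ _ 1) => x y; rewrite mul1r pos_lip.
have cw : continuous (fun z : R * R => weight z.2).
  move=> z; apply: (@continuous_comp _ _ _ snd weight); first exact: cvg_snd.
  exact: is_derive1_continuous (weight_is_derive _).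
have ce : continuous (fun z : R * R => expR (- K * pos z.1)).
  move=> z; apply: (@continuous_comp _ _ _ (fun w : R * R => - K * pos w.1) expR); last exact: continuous_expR.
  by apply: cvgM; [exact: cvg_cst|exact: cp].
have cD : continuous (fun z : R * R => D (pos z.1) z.2).
  by move=> z; apply: cvgB; [exact: cm|apply: cvgM; [exact: cvg_cst|exact: c2]].
move=> z; apply: cvgB.
  apply: cvgM; first exact: ce.
  apply: cvgM; last exact: cw.
  apply: cvgM; rewrite expr2.
    by apply: cvgM; exact: cpm.
  by apply: cvgM; exact: cD.
by apply: cvgM; [exact: cvg_cst|apply: cvgD; [exact: cvg_cst|exact: cp]].
Unshelve. all: by end_near. Qed.

Let Q_le_P t y : 0 <= t <= T -> Q t y <= P t y.
Proof.
move=> /andP[t0 tT]; have P0 : 0 <= P t y.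
  by have w0 := ltW (weight_gt0 y); rewrite /P; nonneg.
rewrite /Q lerBlDr (@le_trans _ _ (P t y))//.
  by rewrite ler_piMl// -[leRHS]expR0 ler_expR mulNr oppr_le0 mulr_ge0.
by rewrite lerDl mulr_ge0 ?(ltW delta_gt0)// addr_ge0.
Qed.

Let Q_max_attained t1 y1 : 0 <= t1 <= T -> 0 < Q t1 y1 ->
  exists t0 y0, [/\ 0 <= t0 <= T, 0 < Q t0 y0 &
    forall t y, 0 <= t <= T -> Q t y <= Q t0 y0].
Proof.
move=> t1T q1.
(* Outside [-N, N] the decay of P keeps Q below Q t1 y1, so the maximum over
the compact box is global. *)
pose N := `|y1| + 1 + 16 * C ^+ 4 / Q t1 y1.
have C4 : 0 <= 16 * C ^+ 4 / Q t1 y1.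
  by rewrite mulr_ge0 ?invr_ge0 ?(ltW q1)// mulr_ge0 ?exprn_ge0.
have y1N : - N <= y1 <= N.
  by rewrite -ler_norml /N; lra.
pose A : set (R * R) := `[0, T]%classic `*` `[- N, N]%classic.
have A1 : A (t1, y1) by split => /=; rewrite in_itv.
have cA : compact A by apply: compact_setX; exact: segment_compact.
have [] := @compact_EVT_max _ _ (fun z : R * R => Q (pos z.1) z.2) A _ cA.
- by exists (t1, y1).
- exact: continuous_subspaceT.
move=> [t0 y0]; rewrite inE => -[/= + _]; rewrite in_itv/= => t0T Hmax.
have Qmax1 t y : 0 <= t <= T -> - N <= y <= N -> Q t y <= Q t0 y0.
  move=> tT yN; have := Hmax (t, y).
  rewrite inE /A /= !in_itv/= tT yN /pos !max_r; [by apply|by case/andP: t0T|by case/andP: tT].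
exists t0, y0; split => //; first exact: lt_le_trans (Qmax1 t1 y1 t1T y1N).
move=> t y tT; have [yN|yN] := boolP (- N <= y <= N); first exact: Qmax1.
apply: le_trans (Qmax1 t1 y1 t1T y1N); apply: (le_trans (Q_le_P y tT)).
apply: (le_trans (P_decay y tT)).
have s0 : 0 < 1 + y ^+ 2 by rewrite (lt_le_trans ltr01)// lerDl sqr_ge0.
rewrite ler_pdivrMr// [leRHS]mulrC -ler_pdivrMr//.
have : N <= `|y| by rewrite leNgt; apply: contra yN => /ltW; rewrite ler_norml.
have : `|y| <= 1 + y ^+ 2.
  by have := sqr_ge0 (`|y| - 1); rewrite sqrrB1 real_normK ?num_real//; have := normr_ge0 y; lra.
by rewrite /N; have := normr_ge0 y1; lra.
Qed.

Let Q_le0 t y : 0 <= t <= T -> Q t y <= 0.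
Proof.
move=> tT; rewrite leNgt; apply/negP => /(Q_max_attained tT)[t0 [y0 [t0T Q0 Qmax]]].
have t00 : 0 < t0.
  rewrite lt_neqAle (andP t0T).1 andbT; apply/eqP => t0E.
  by move: Q0; rewrite -t0E ltNge Q_initial.
have t0T' : 0 < t0 <= T by rewrite t00 (andP t0T).2.
have P0 : 0 < P t0 y0 by exact: lt_le_trans Q0 (Q_le_P _ t0T).
have M0 : 0 < m t0 y0.
  rewrite ltNge; apply/negP => M0; move: P0.
  by rewrite /P /pos max_l// expr0n/= !mul0r ltxx.
have posM : pos (m t0 y0) = m t0 y0 by rewrite /pos max_r// ltW.
pose M := m t0 y0; pose d := D t0 y0; pose w := weight y0.
pose X := expR (- K * t0).
have X0 : 0 < X <= 1.
  by rewrite expR_gt0 -[leRHS]expR0 ler_expR mulNr oppr_le0 mulr_ge0 // ltW.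
have PE : P t0 y0 = M ^+ 2 * d ^+ 2 * w by rewrite /P posM.
have dt : is_derive t0 1 (Q ^~ y0)
   (X * w * (2 * M * d ^+ 2 * mt t0 y0 + 2 * M ^+ 2 * d * mt t0 y0)
       - K * (X * (M ^+ 2 * d ^+ 2 * w)) - delta).
  have dm := m_t y0 t00.
  have dp : is_derive t0 1 (fun t => pos (m t y0) ^+ 2) (2 * M * mt t0 y0).
    by have := is_derive1_comp (pos_sqr_derive (m t0 y0)) dm; rewrite posM.
  have de : is_derive t0 1 (fun t => expR (- K * t)) (- K * X).
    have dl : is_derive t0 1 (fun t : R => - K * t) (- K).
      by apply: is_derive_eq; rewrite /GRing.scale /= ; ring.
    by have := is_derive1_comp (is_derive_expR (- K * t0)) dl; rewrite mulrC.
  have dD : is_derive t0 1 (fun t => D t y0) (mt t0 y0).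
    by apply: is_derive_eq; rewrite ?subr0.
  rewrite (_ : Q ^~ y0 = (fun t => expR (- K * t)) *
    ((fun t => pos (m t y0) ^+ 2) * (fun t => D t y0) ^+ 2 * cst w)
    - (cst delta * (cst 1 + id))); last by apply/funext.
  apply: is_derive_eq; rewrite /GRing.scale /= !fctE posM -/M -/d -/X.
  by ring.
have dy y1 : is_derive y1 1 (Q t0) (X *
   (2 * pos (m t0 y1) * my t0 y1 * D t0 y1 ^+ 2 * weight y1 +
    2 * pos (m t0 y1) ^+ 2 * D t0 y1 * (my t0 y1 - a) * weight y1 +
    pos (m t0 y1) ^+ 2 * D t0 y1 ^+ 2 * weight' y1)).
  have dm := m_y y1 (ltW t00).
  have dp : is_derive y1 1 (fun y => pos (m t0 y) ^+ 2) (2 * pos (m t0 y1) * my t0 y1).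
    exact: is_derive1_comp (pos_sqr_derive (m t0 y1)) dm.
  have dD : is_derive y1 1 (D t0) (my t0 y1 - a).
    by apply: is_derive_eq; rewrite /GRing.scale /=; ring.
  have dw := weight_is_derive y1.
  rewrite (_ : Q t0 = cst X *
    ((fun y => pos (m t0 y) ^+ 2) * (D t0) ^+ 2 * weight)
    - cst (delta * (1 + t0))); last by apply/funext.
  apply: is_derive_eq; rewrite /GRing.scale /= !fctE.
  by ring.
have Yzero := is_derive_global_max dy (fun y => Qmax t0 y t0T).
have Tpos : 0 <= X * w * (2 * M * d ^+ 2 * mt t0 y0 + 2 * M ^+ 2 * d * mt t0 y0)
       - K * (X * (M ^+ 2 * d ^+ 2 * w)) - delta.
  apply: (is_derive_left_max t00 dt) => s; rewrite subrr => /andP[s0 st].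
  by apply: Qmax; rewrite (ltW s0) (le_trans (ltW st))// (andP t0T).2.
have w0 : 0 <= w by exact: ltW (weight_gt0 _).
have Mle : M <= C * (1 + `|y0|) by rewrite (le_trans (ler_norm _))// m_growth.
have dle : `|d| <= 2 * C * (1 + `|y0|) by exact: D_growth.
have d2le : d ^+ 2 <= (2 * C * (1 + `|y0|)) ^+ 2.
  by rewrite -(real_normK (num_real d)) lerXn2r ?nnegrE//; nonneg.
apply: (@barrier_contradiction _ C a eps X M d (D t0 (y0 + eta)) w (weight' y0)
   (c t0 y0) (mt t0 y0) (my t0 y0) S (16 * C ^+ 3) delta) => //.
- exact: ltW.
- exact: weight'_le.
- exact: transport.
- exact: c_le.
- exact: c_local.
- rewrite [leRHS](_ : _ = 4 * C ^+ 3 * 4); last by ring.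
  apply: (@le_trans _ _ (4 * C ^+ 3 * ((1 + `|y0|) ^+ 3 * w))); last first.
    by rewrite ler_wpM2l ?weight_cube// mulr_ge0 ?exprn_ge0.
  rewrite [leRHS](_ : _ = C * (1 + `|y0|) * (2 * C * (1 + `|y0|)) ^+ 2 * w); last by ring.
  by rewrite ler_wpM2r// ler_pM ?(ltW M0) ?sqr_ge0.
- rewrite [leRHS](_ : _ = 4 * C ^+ 3 * 4); last by ring.
  apply: (@le_trans _ _ (4 * C ^+ 3 * ((1 + `|y0|) ^+ 3 * w))); last first.
    by rewrite ler_wpM2l ?weight_cube// mulr_ge0 ?exprn_ge0.
  apply: (@le_trans _ _ ((C * (1 + `|y0|)) ^+ 2 * (2 * C * (1 + `|y0|)) * w)).
    rewrite ler_wpM2r// ler_pM ?sqr_ge0 ?dle//.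
    by rewrite lerXn2r ?nnegrE ?(ltW M0)//; nonneg.
  rewrite (_ : _ * w = 2 * C ^+ 3 * ((1 + `|y0|) ^+ 3 * w)); last by ring.
  have : 0 <= C ^+ 3 * ((1 + `|y0|) ^+ 3 * w).
    by rewrite mulr_ge0 ?exprn_ge0// mulr_ge0 ?exprn_ge0 ?addr_ge0.
  by lra.
- have P1 : X * P t0 (y0 + eta) <= X * P t0 y0.
    by have := Qmax t0 (y0 + eta) t0T; rewrite /Q -/X; lra.
  rewrite -PE (le_trans _ (ler_wpM2l S_ge0 P1))// [leRHS]mulrCA ler_wpM2l ?(ltW (expR_gt0 _))//.
  rewrite /P (_ : S * _ = pos (m t0 (y0 + eta)) ^+ 2 * D t0 (y0 + eta) ^+ 2
    * (S * weight (y0 + eta))); last by ring.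
  rewrite ler_pM ?weight_shift//; first by nonneg.
  rewrite ler_wpM2r ?sqr_ge0// lerXn2r ?nnegrE ?pos_ge0 ?(ltW M0)//.
  by rewrite /pos le_max m_nd ?orbT// lerDl.
- apply/eqP; move/eqP: Yzero; rewrite posM mulf_eq0 gt_eqF ?expR_gt0//.
- have C45 : C ^+ 4 <= C ^+ 5 by rewrite [leRHS]exprS ler_peMl ?exprn_ge0.
  rewrite /delta ltr_pM2r//.
  rewrite (_ : _ * (16 * C ^+ 3) = 64 * C ^+ 4 + 32 * C ^+ 5); last by ring.
  have : 0 < C ^+ 5 by rewrite exprn_gt0// (lt_le_trans ltr01).
  by lra.
Qed.

(** If m is transported by c up to an error C eps, and c is controlled by
the defect D at y and y + eta, then the defect is of order sqrt eps wherever m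
is bounded away from 0.  The factor max(m, 0) localizes to the region occupied
by mass that started ahead of the front: m is nondecreasing in y, so this
region contains y + eta whenever it contains y. *)
Lemma front_barrier t y : 0 <= t <= T ->
  pos (m t y) ^+ 2 * (m t y - a * y) ^+ 2 * weight y <=
    barrier_const T C eta * eps.
Proof.
move=> tT; have /andP[t0 tT'] := tT.
have := Q_le0 y tT; rewrite /Q subr_le0 mulNr expRN ler_pdivrMl ?expR_gt0// => H.
rewrite -/(P t y) (le_trans H)//.
rewrite (_ : _ * eps = expR (K * T) * (delta * (1 + T))); last first.
  by rewrite /barrier_const -/K /delta; ring.
apply: ler_pM; rewrite ?expR_ge0 ?ler_expR ?ler_wpM2l ?(ltW delta_gt0) ?lerD2l//.
by rewrite mulr_ge0 ?(ltW delta_gt0) ?addr_ge0.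
Qed.
End front_rigidity.

(** * From the weak equation to classical derivatives in time *)

Section du_bois_reymond.
Context {R : realType}.
Local Notation mu := (@lebesgue_measure R).
Implicit Types (f G A B : R -> R) (s t x e a b : R).

Lemma tame_mul_window f a b : continuous f -> tame (fun x => f x * window a b x).
Proof.
move=> cf; have mf : measurable_fun setT (fun x => f x * window a b x).
  by apply: measurable_funM; [exact: continuous_measurable_fun|exact: measurable_window].
have [ab|ba] := leP a b; last first.
  apply: (@tameP _ _ 0 a b) => // x; rewrite window_out ?mulr0 ?normr0//.
  by apply/negP => /andP[ax xb]; move: (le_trans ax xb); rewrite leNgt ba.
have cn : {within `[a, b], continuous (fun x => `|f x|)}.
  by apply: continuous_subspaceT => x; apply: cvg_norm; exact: cf.
have [c _ cmax] := EVT_max ab cn.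
apply: (@tameP _ _ `|f c| a b) => // x; rewrite normrM (ger0_norm (window_ge0 _ _ _)).
case: (boolP (a <= x <= b)) => H; last by rewrite window_out// !mulr0.
by rewrite ler_wpM2r ?window_ge0// cmax// in_itv.
Qed.

Lemma tame_continuous f a b : continuous f ->
  (forall x, ~~ (a <= x <= b) -> f x = 0) -> tame f.
Proof.
move=> cf f0; rewrite (_ : f = fun x => f x * window a b x).
  exact: tame_mul_window.
apply/funext => x; case: (boolP (a <= x <= b)) => H; first by rewrite window_in// mulr1.
by rewrite f0// mul0r.
Qed.

Lemma bump_average e s G (k : R) : 0 < e -> continuous G ->
  (forall x, s <= x <= s + 2 * e -> `|G x - G s| <= k) ->
  `|intR (fun x => bump e (x - s) * G x) - G s| <= k.
Proof.
move=> e0 cG Gk.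
have tb := tame_bump e0 s.
have tG : tame (fun x => bump e (x - s) * G x).
  apply: (@tame_continuous _ s (s + 2 * e)).
    by move=> x; apply: cvgM; [exact: continuous_bump_shift|exact: cG].
  by move=> x H; rewrite bump_window// (@window_out _ _ _ _ H) mulr0 mul0r.
rewrite -[X in _ - X]mulr1 -(intR_bump e0 s) -intRZ// -intRB//; last exact: tameZ.
rewrite -[leRHS]mulr1 -(intR_bump e0 s) -intRZ//.
apply: le_norm_intR; [by apply: tameB => //; exact: tameZ|exact: tameZ|].
move=> x; rewrite (mulrC (G s)) -mulrBr normrM ger0_norm ?bump_ge0// mulrC.
case: (boolP (s <= x <= s + 2 * e)) => H; first by rewrite ler_wpM2r ?bump_ge0 ?Gk.
by rewrite bump_window// (@window_out _ _ _ _ H) !mulr0.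
Qed.

Lemma continuous_right_modulus G s (k : R) : continuous G -> 0 < k ->
  exists2 d, 0 < d & forall e x, 0 < e <= d -> s <= x <= s + 2 * e -> `|G x - G s| <= k.
Proof.
move=> cG k0; have /cvgrPdist_le /(_ _ k0) := cG s.
move=> [d /= d0 Hd]; exists (d / 3); first by rewrite divr_gt0.
move=> e x /andP[e0 ed] /andP[sx xe]; rewrite distrC; apply: Hd => /=.
by rewrite ler0_norm; lra.
Qed.

(** If F is a primitive of B then testing with a smoothed indicator of
[s, s'] and integrating by parts shows that A - F has the same average over
short intervals to the right of s and of s'; hence it is constant. *)
Lemma du_bois_reymond A B : continuous A -> continuous B ->
  (forall s s' e, 0 < s -> 0 < s' -> 0 < e ->
    \int[mu]_(t in `]0, +oo[) ((bump e (t - s) - bump e (t - s')) * A t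
      + (ramp e (t - s) - ramp e (t - s')) * B t) = 0) ->
  forall t, 0 < t -> is_derive t 1 A (B t).
Proof.
move=> cA cB H; have [F dF] := primitive_exists cB.
have cF : continuous F by move=> x; exact: is_derive1_continuous (dF x).
pose G t := A t - F t.
have cG : continuous G by move=> x; apply: cvgB; [exact: cA|exact: cF].
have tbG e s : 0 < e -> tame (fun x => bump e (x - s) * G x).
  move=> e0; apply: (@tame_continuous _ s (s + 2 * e)).
    by move=> x; apply: cvgM; [exact: continuous_bump_shift|exact: cG].
  by move=> x sx; rewrite bump_window// (@window_out _ _ _ _ sx) mulr0 mul0r.
have G_avg s s' e : 0 < s -> 0 < s' -> 0 < e ->
    intR (fun x => bump e (x - s) * G x) = intR (fun x => bump e (x - s') * G x).
  move=> s0 s'0 e0.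
  (* chi is a smoothed indicator of the interval between s and s'. *)
pose chi t := ramp e (t - s) - ramp e (t - s').
  pose chi' t := bump e (t - s) - bump e (t - s').
  pose N := Num.max s s' + 2 * e.
  have sN : s + 2 * e <= N by rewrite lerD2r le_max lexx.
  have s'N : s' + 2 * e <= N by rewrite lerD2r le_max lexx orbT.
  have dchi x : is_derive x 1 chi (chi' x).
    have := ramp_taylor e0 (x - s) => r1; have := ramp_taylor e0 (x - s') => r2.
    apply: (@quadratic_is_derive _ _ _ _ (2 / e ^+ 2 + 2 / e ^+ 2)) => h.
    move: (r1 h) (r2 h); rewrite /chi /chi' !(addrAC x h) mulrDl.
    by rewrite !ler_norml; lra.
  have cchi' : continuous chi'.
    by move=> x; apply: cvgB; exact: continuous_bump_shift.
  have cchi : continuous chi by move=> x; exact: is_derive1_continuous (dchi x).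
  have chi_left x : x <= 0 -> chi x = 0 /\ chi' x = 0.
    move=> x0; rewrite /chi /chi' !(ramp_left e0); try lra.
    by rewrite !(bump_out e0) ?subrr//; apply/negP; lra.
  have chi_out x : ~~ (0 <= x <= N) -> chi x = 0 /\ chi' x = 0.
    rewrite negb_and -!ltNge => /orP[/ltW /chi_left//|xN].
    rewrite /chi /chi' !(ramp_right e0); try lra.
    by rewrite !(bump_out e0) ?subrr//; apply/negP; lra.
  have dchiF x : is_derive x 1 (fun x => chi x * F x) (chi' x * F x + chi x * B x).
    have d1 := dchi x; have d2 := dF x.
    by apply: is_derive_eq; rewrite /GRing.scale /=; ring.
  have cchiF : continuous (fun x => chi' x * F x + chi x * B x).
    move=> x; apply: cvgD.
      by apply: cvgM; [exact: cchi'|exact: cF].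
    by apply: cvgM; [exact: cchi|exact: cB].
  have N0 : 0 < N by apply: lt_le_trans sN; lra.
  have I0 : intR (fun x => chi' x * F x + chi x * B x) = 0.
    rewrite (eq_intR (g := fun x => (chi' x * F x + chi x * B x) * window 0 N x)).
      rewrite (ftc2_intR N0 cchiF dchiF) (chi_left 0 (lexx 0)).1.
      by rewrite /chi !(ramp_right e0) ?subrr ?mul0r ?subrr//; lra.
    move=> x; case: (boolP (0 <= x <= N)) => xN; first by rewrite window_in// mulr1.
    by have [-> ->] := chi_out x xN; rewrite !mul0r addr0 mul0r.
  have tchiF : tame (fun x => chi' x * F x + chi x * B x).
    apply: (@tame_continuous _ 0 N cchiF) => x /chi_out [-> ->].
    by rewrite !mul0r addr0.
  have := H _ _ _ s0 s'0 e0; rewrite Rintegral_mkcond.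
  rewrite (_ : Rintegral _ _ _ = intR (fun x => (chi' x * F x + chi x * B x) +
      (bump e (x - s) * G x - bump e (x - s') * G x))).
    rewrite intRD; [|exact: tchiF|by apply: tameB; exact: tbG].
    by rewrite I0 add0r intRB; [exact: subr0_eq|exact: tbG|exact: tbG].
  apply: eq_intR => x; rewrite patchE mem_setE in_itv /= andbT.
  case: ltP => x0; first by rewrite /chi /chi' /G; ring.
  have [chi0 chi'0] := chi_left x x0.
  have bb : bump e (x - s) = bump e (x - s') by exact: subr0_eq.
  by rewrite chi0 chi'0 bb !mul0r subrr !addr0.
have G_eq s s' : 0 < s -> 0 < s' -> G s = G s'.
  move=> s0 s'0; apply/eqP; rewrite -subr_eq0 -normr_le0; apply/ler_addgt0Pl => k k0; rewrite addr0.
  have k2 : 0 < k / 2 by rewrite divr_gt0.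
  have [d d0 Hd] := continuous_right_modulus s cG k2.
  have [d' d'0 Hd'] := continuous_right_modulus s' cG k2.
  have m0 : 0 < Num.min d d' by rewrite lt_min d0.
  have := bump_average m0 cG (fun x => Hd _ x _).
  have := bump_average m0 cG (fun x => Hd' _ x _).
  rewrite m0 !ge_min !lexx orbT /= => /(_ isT) b' /(_ isT) b1.
  move: b1 b'; rewrite (G_avg s s')// !ler_norml; lra.
move=> t t0; apply: (@near_eq_is_derive _ _ _ (fun x => G t + F x)).
  near=> x; rewrite -(G_eq x t)//; first by rewrite /G subrK.
  by near: x; exact: lt_nbhsr.
have dFt := dF t; rewrite (_ : (fun x => G t + F x) = cst (G t) + F)//.
by apply: is_derive_eq; rewrite add0r.
Unshelve. all: by end_near. Qed.
End du_bois_reymond.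

(** * Integrals against moving kernels *)

Section pairings.
Context {R : realType}.
Implicit Types (g : R -> R -> R) (K : R -> R) (s t x y e b : R).

(** The common features of the density and of the flux relative to the front. *)
Record L1loc_field (B : R) g : Prop := {
  field_measurable : forall t, measurable_fun setT (g t);
  field_bound : forall t x, `|g t x| <= B;
  field_continuous : forall t N e, 0 < e ->
    \forall s \near t, intR (fun x => `|g s x - g t x| * window (- N) N x) <= e }.

Record kernel (C M : R) K : Prop := {
  kernel_lip : forall x y, `|K x - K y| <= C * `|x - y|;
  kernel_supp : forall x, M < `|x| -> K x = 0 }.

Lemma kernel_continuous C M K : kernel C M K -> continuous K.
Proof. by move=> [lipK _]; exact: lipschitz_continuous lipK. Qed.

Lemma kernel_bound C M K : kernel C M K ->
  exists2 B : R, 0 <= B & forall x, `|K x| <= B.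
Proof.
move=> kK; have tK : tame K.
  apply: (@tame_continuous _ _ (- M) M (kernel_continuous kK)) => x.
  by rewrite -ler_norml -ltNge; exact: kernel_supp kK x.
have [_ [D [N KD]]] := tK; exists `|D| => // x.
apply: (le_trans (KD x)); apply: (@le_trans _ _ (`|D| * window (- N) N x)).
  by rewrite ler_wpM2r ?window_ge0 ?ler_norm.
by rewrite ler_piMr ?window_le1.
Qed.

Lemma tame_kernel_shift C M K c : kernel C M K -> tame (fun x => K (x - c)).
Proof.
move=> kK; apply: (@tame_continuous _ _ (c - M) (c + M)).
  apply: (@lipschitz_continuous _ _ C) => x y.
  by rewrite (le_trans (kernel_lip kK _ _))// (_ : x - c - _ = x - y)//; ring.
move=> x; rewrite -ler_distl -ltNge => xM.
by rewrite (kernel_supp kK).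
Qed.

Lemma tame_field_mul (B : R) g t f : L1loc_field B g -> tame f -> tame (fun x => g t x * f x).
Proof. by move=> fg; apply: tameM; [exact: field_measurable fg t|exact: field_bound fg t]. Qed.

Variables (b vbar : R).

Definition front t : R := b + vbar * t.

Definition pairing g K t : R := intR (fun x => g t x * K (x - front t)).

(** The kernel moves with the front, so the change in t comes both from the
field, controlled in L1loc, and from the kernel, controlled by its Lipschitz
constant. *)
Lemma pairing_continuous B g C M K : L1loc_field B g -> kernel C M K ->
  continuous (pairing g K).
Proof.
move=> fg kK t.
have B0 : 0 <= B := le_trans (normr_ge0 _) (field_bound fg 0 0).
have C0 : 0 <= C.
  have := kernel_lip kK 1 0; rewrite subr0 normr1 mulr1.
  exact: le_trans (normr_ge0 _).
have [BK BK0 KB] := kernel_bound kK.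
pose N := `|M| + `|front t| + 1.
have N0 : 0 <= N by rewrite /N !addr_ge0.
have K_out s x : `|front s - front t| <= 1 -> ~~ (- N <= x <= N) -> K (x - front s) = 0.
  move=> st; rewrite -ler_norml -ltNge => xN; apply: (kernel_supp kK).
  have := ler_norm M; have := ler_normD (x - front s) (front s).
  have := ler_normD (front s - front t) (front t); rewrite !subrK.
  by move: xN; rewrite /N; lra.
apply/cvgrPdist_le => e e0.
pose e1 := e / 2 / (BK + 1).
pose e2 := e / 2 / (B * C * (N + N) + 1).
have BC0 : 0 <= B * C * (N + N) by nonneg.
have e10 : 0 < e1 by rewrite !divr_gt0// ltr_wpDl.
have e20 : 0 < e2 by rewrite !divr_gt0// ltr_wpDl.
have cf : continuous front.
  by move=> s; apply: cvgD; [exact: cvg_cst|apply: cvgM; [exact: cvg_cst|exact: cvg_id]].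
near=> s.
have st1 : `|front s - front t| <= 1.
  by rewrite distrC; near: s; move/cvgrPdist_le: (cf t); exact.
have st2 : `|front s - front t| <= e2.
  by rewrite distrC; near: s; move/cvgrPdist_le: (cf t); exact.
have gs : intR (fun x => `|g s x - g t x| * window (- N) N x) <= e1.
  by near: s; exact: (field_continuous fg t N e10).
have tb u : tame (fun x => g u x * K (x - front u)).
  by apply: (tame_field_mul _ fg); exact: (tame_kernel_shift _ kK).
have td : tame (fun x => `|g s x - g t x| * window (- N) N x).
  apply: (@tameM _ _ _ (B + B)); last exact: tame_window.
    apply: measurableT_comp => //; apply: measurable_funB; exact: (field_measurable fg).
  move=> x; rewrite normr_id (le_trans (ler_normB _ _))// lerD//; exact: (field_bound fg).
pose h x := BK * (`|g s x - g t x| * window (- N) N x) + B * C * e2 * window (- N) N x.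
have th1 : tame (fun x => BK * (`|g s x - g t x| * window (- N) N x)) by exact: tameZ.
have th2 : tame (fun x => B * C * e2 * window (- N) N x).
  by apply: tameZ; exact: tame_window.
apply: (@le_trans _ _ (intR h)).
  apply: le_dist_intR => //; first exact: tameD.
  move=> x; rewrite /h; have [xN|xN] := boolP (- N <= x <= N); last first.
    by rewrite !K_out ?subrr ?normr0 ?mulr0 ?subrr ?normr0// !window_out// !mulr0 addr0.
  rewrite window_in// !mulr1.
  rewrite (_ : _ - _ = (g t x - g s x) * K (x - front s)
    + g t x * (K (x - front t) - K (x - front s))); last by ring.
  rewrite (le_trans (ler_normD _ _))// !normrM lerD//.
    by rewrite mulrC distrC ler_wpM2r.
  rewrite -mulrA; apply: ler_pM => //; first exact: (field_bound fg).
  rewrite (le_trans (kernel_lip kK _ _))// ler_wpM2l//.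
  by rewrite (_ : x - front t - _ = front s - front t)//; ring.
rewrite /h intRD// !intRZ//; last exact: tame_window.
have NN : - N <= N by lra.
rewrite (intR_window NN).
have h1 : BK * intR (fun x => `|g s x - g t x| * window (- N) N x) <= e / 2.
  apply: (@le_trans _ _ (BK * e1)); first by rewrite ler_wpM2l.
  rewrite /e1 mulrA ler_pdivrMr; last by rewrite ltr_wpDl.
  by rewrite mulrC ler_wpM2l ?divr_ge0 ?(ltW e0)//; lra.
have h2 : B * C * e2 * (N - - N) <= e / 2.
  rewrite opprK mulrAC /e2 mulrA ler_pdivrMr; last by rewrite ltr_wpDl.
  by rewrite mulrC ler_wpM2l ?divr_ge0 ?(ltW e0)//; lra.
by lra.
Unshelve. all: by end_near. Qed.
End pairings.

(** * Comparing smooth and sharp windows *)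

Section windows.
Context {R : realType}.
Implicit Types (p q x y z e : R).

Lemma window_shift_dist x y (d : R) z : 0 <= d -> x <= y ->
  `|window x (x + d) z - window y (y + d) z| <= window x y z + window (x + d) (y + d) z.
Proof.
move=> d0 xy; rewrite /window.
case: (boolP (x <= z <= x + d)) => [/andP[h1 h2]|H1];
case: (boolP (y <= z <= y + d)) => [/andP[h3 h4]|H2];
case: (boolP (x <= z <= y)) => [/andP[h5 h6]|H3];
case: (boolP (x + d <= z <= y + d)) => [/andP[h7 h8]|H4];
rewrite /= ?subrr ?sub0r ?subr0 ?normrN ?normr1 ?normr0; try lra.
Qed.

Variable e : R.
Hypothesis e0 : 0 < e.

(** A smooth window with edges of width 2 e differs from the sharp one only
at the two edges. *)
Lemma ramp_window_dist p q z : p <= q ->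
  `|ramp e (z - p) - ramp e (z - q) - window p q z| <=
    window p (p + 2 * e) z + window q (q + 2 * e) z.
Proof.
have e_gt0 := e0.
move=> pq.
have r1 := ramp_ge0 e0 (z - p); have r2 := ramp_le1 e0 (z - p).
have r3 := ramp_ge0 e0 (z - q); have r4 := ramp_le1 e0 (z - q).
have r5 : ramp e (z - q) <= ramp e (z - p) by apply: ramp_nd => //; lra.
have [zp|pz] := ltP z p.
  rewrite !(ramp_left e0); try lra.
  rewrite (@window_out _ p q) ?subrr ?subr0 ?normr0 ?addr_ge0 ?window_ge0//; apply/negP; lra.
have [zpe|pez] := leP z (p + 2 * e).
  rewrite (@window_in _ p (p + 2 * e)); last by rewrite pz.
  have := window_ge0 p q z; have := window_le1 p q z; have := window_ge0 q (q + 2 * e) z.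
  by rewrite ler_norml; lra.
rewrite (ramp_right e0 (z := z - p)); last by lra.
have [zq|qz] := ltP z q.
  rewrite (ramp_left e0); last by lra.
  rewrite (@window_in _ p q) ?pz ?(ltW zq)// subr0 subrr normr0.
  by rewrite addr_ge0 ?window_ge0.
have [zqe|qez] := leP z (q + 2 * e).
  rewrite (@window_in _ q (q + 2 * e)); last by rewrite qz.
  have := window_ge0 p q z; have := window_le1 p q z; have := window_ge0 p (p + 2 * e) z.
  by rewrite ler_norml; lra.
rewrite (ramp_right e0); last by lra.
rewrite (@window_out _ p q) ?subrr ?subr0 ?normr0 ?addr_ge0 ?window_ge0//; apply/negP; lra.
Qed.

Lemma ramp_diff_le p q z :
  `|ramp e (z - p) - ramp e (z - q)| <= window (Num.min p q) (Num.max p q + 2 * e) z.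
Proof.
have e_gt0 := e0.
wlog pq : p q / p <= q.
  move=> H; have [/H//|/H] := orP (le_total p q).
  by rewrite distrC minC (maxC q).
rewrite min_l// max_r//.
have r1 := ramp_ge0 e0 (z - p); have r2 := ramp_le1 e0 (z - p).
have r3 := ramp_ge0 e0 (z - q); have r4 := ramp_le1 e0 (z - q).
have [zp|pz] := ltP z p.
  rewrite !(ramp_left e0); try lra.
  by rewrite subrr normr0 window_ge0.
have [zqe|qez] := leP z (q + 2 * e); first by rewrite window_in ?pz// ler_norml; lra.
rewrite !(ramp_right e0); try lra.
by rewrite subrr normr0 window_ge0.
Qed.

Lemma ramp_kernel p q :
  kernel (2 / e) (`|p| + `|q| + 2 * e) (fun z => ramp e (z - p) - ramp e (z - q)).
Proof.
have e_gt0 := e0.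
have ramp_lip x y : `|ramp e x - ramp e y| <= e^-1 * `|x - y|.
  wlog xy : x y / y <= x.
    move=> H; have [/H//|/H] := orP (le_total y x).
    by rewrite distrC (distrC y).
  rewrite ger0_norm ?subr_ge0 ?ramp_nd// ger0_norm ?subr_ge0//.
  apply: (@le_is_derive _ _ (bump e)) => //.
  - by move=> z _; exact: ramp_derive.
  - by apply: continuous_subspaceT => z; exact: is_derive1_continuous (ramp_derive e0 z).
  - by move=> z _; exact: bump_le.
split=> [x y|x xM].
  rewrite (_ : _ - _ = (ramp e (x - p) - ramp e (y - p)) - (ramp e (x - q) - ramp e (y - q))); last by ring.
  rewrite (le_trans (ler_normB _ _))//.
  have := ramp_lip (x - p) (y - p); have := ramp_lip (x - q) (y - q).
  rewrite (_ : x - p - _ = x - y); last by ring.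
  rewrite (_ : x - q - _ = x - y); last by ring.
  by rewrite (_ : 2 / e * _ = 2 * (e^-1 * `|x - y|)); [lra|ring].
apply/eqP; rewrite -normr_le0 (le_trans (ramp_diff_le p q x))// window_out//.
apply/negP => /andP[]; move: xM; rewrite ltNge ler_norml => /negP xM h1 h2.
apply: xM; move: h1 h2; have := ler_norm p; have := ler_norm q.
have := ler_norm (- p); have := ler_norm (- q); rewrite !normrN.
have := normr_ge0 p; have := normr_ge0 q.
by case: (leP p q) => pq; lra.
Qed.

Lemma bump_kernel p q :
  kernel (8 / e ^+ 2) (`|p| + `|q| + 2 * e) (fun z => bump e (z - p) - bump e (z - q)).
Proof.
have e_gt0 := e0.
split=> [x y|x xM].
  rewrite (_ : _ - _ = (bump e (x - p) - bump e (y - p)) - (bump e (x - q) - bump e (y - q))); last by ring.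
  rewrite (le_trans (ler_normB _ _))//.
  have := bump_lip e (x - p) (y - p); have := bump_lip e (x - q) (y - q).
  rewrite (_ : x - p - _ = x - y); last by ring.
  rewrite (_ : x - q - _ = x - y); last by ring.
  by rewrite (_ : 8 / _ * _ = 2 * (4 / e ^+ 2 * `|x - y|)); [lra|ring].
have far c : `|c| + 2 * e < `|x| -> bump e (x - c) = 0.
  move=> xc; apply: (bump_out e0); apply/negP => /andP[h1 h2].
  move: xc; rewrite ltNge ler_norml => /negP; apply.
  by have := ler_norm c; have := ler_norm (- c); rewrite normrN; lra.
by have := normr_ge0 p; have := normr_ge0 q => ? ?; rewrite !far ?subrr//; lra.
Qed.

Lemma single_bump_kernel p : kernel (4 / e ^+ 2) (`|p| + 2 * e) (fun z => bump e (z - p)).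
Proof.
have e_gt0 := e0.
split=> [x y|x xM].
  by rewrite (le_trans (bump_lip _ _ _))// (_ : x - p - _ = x - y)//; ring.
apply: (bump_out e0); apply/negP => /andP[h1 h2].
move: xM; rewrite ltNge ler_norml => /negP; apply.
by have := ler_norm p; have := ler_norm (- p); rewrite normrN; lra.
Qed.

End windows.

(** * Constancy ahead of the front and decay behind it *)

Section traffic.
Context {R : realType}.
Implicit Types (s t x y z e : R).
Variables (eta L lmax rmin rmax b vbar rhobar : R) (vh dvh : R -> R).
Variable r : R -> R -> R.

Definition averaged t x : R := eta^-1 * intR (fun y => r t y * window x (x + eta) y).
Definition velocity t x : R := vh (averaged t x).
(** The flux seen from the leading vehicle. *)
Definition relative_flow t x : R := r t x * (velocity t x - vbar).

Local Notation front := (front b vbar).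
Local Notation pairing := (pairing b vbar).

Hypothesis eta0 : 0 < eta.
Hypothesis rmin0 : 0 <= rmin.
Hypothesis r_field : L1loc_field rmax r.
Hypothesis r_ge : forall t x, rmin <= r t x.
Hypothesis vh_derive : forall x, is_derive x 1 vh (dvh x).
Hypothesis dvh_ge : forall x, - L <= dvh x.
Hypothesis dvh_le : forall x, dvh x <= lmax.
Hypothesis lmax0 : lmax < 0.
Hypothesis vh_rhobar : vh rhobar = vbar.
Hypothesis rhobar_bound : 0 < rhobar <= rmax.

Let L0 : 0 <= L.
Proof. by have := dvh_ge 0; have := dvh_le 0; have := lmax0; lra. Qed.

Let rmax0 : 0 < rmax.
Proof. by have /andP[h1 h2] := rhobar_bound; exact: lt_le_trans h2. Qed.

Let r_le t x : r t x <= rmax.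
Proof. exact: le_trans (ler_norm _) (field_bound r_field t x). Qed.

Let r_ge0 t x : 0 <= r t x.
Proof. exact: le_trans (r_ge t x). Qed.

Lemma vh_lipschitz x y : `|vh x - vh y| <= L * `|x - y|.
Proof.
wlog xy : x y / y <= x.
  move=> H; have [/H//|/H] := orP (le_total y x).
  by rewrite distrC (distrC y).
have cv : {within `[y, x], continuous vh}.
  by apply: continuous_subspaceT => z; exact: is_derive1_continuous (vh_derive z).
have [z _ ->] := MVT_segment xy (fun z _ => vh_derive z) cv.
rewrite normrM ler_wpM2r// ler_norml dvh_ge /=.
by have := dvh_le z; have := lmax0; have := L0; lra.
Qed.

Let tame_r t f : tame f -> tame (fun x => r t x * f x).
Proof. exact: tame_field_mul r_field. Qed.

Lemma averaged_bound t x : 0 <= averaged t x <= rmax.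
Proof.
have e1 : 0 <= eta^-1 by rewrite invr_ge0 ltW.
have tw := tame_window x (x + eta).
have xe : x <= x + eta by rewrite lerDl ltW.
apply/andP; split.
  rewrite mulr_ge0// -[leLHS](mul0r (intR (window x (x + eta)))) -intRZ//.
  by apply: le_intR => [||y]; [exact: tameZ|exact: tame_r|rewrite ler_wpM2r ?window_ge0].
rewrite /averaged mulrC ler_pdivrMr// -[X in _ <= rmax * X](_ : x + eta - x = eta); last by ring.
rewrite -(intR_window xe) -intRZ//.
by apply: le_intR => [||y]; [exact: tame_r|exact: tameZ|rewrite ler_wpM2r ?window_ge0].
Qed.

Lemma averaged_lipschitz t x y :
  `|averaged t x - averaged t y| <= 2 * rmax / eta * `|x - y|.
Proof.
wlog xy : x y / x <= y.
  move=> H; have [/H//|/H] := orP (le_total x y).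
  by rewrite distrC (distrC y).
have tw p q := tame_window p q.
rewrite /averaged -mulrBr normrM ger0_norm ?invr_ge0 ?(ltW eta0)//.
rewrite [leRHS](_ : _ = eta^-1 * (rmax * (2 * `|x - y|))); last by ring.
rewrite ler_wpM2l ?invr_ge0 ?(ltW eta0)//.
have -> : `|x - y| = y - x by rewrite distrC ger0_norm ?subr_ge0.
have xye : x + eta <= y + eta by rewrite lerD2r.
rewrite (_ : 2 * _ = (y - x) + (y + eta - (x + eta))); last by ring.
rewrite -(intR_window xy) -(intR_window xye) -intRD// -intRZ; last exact: tameD.
apply: le_dist_intR; [exact: tame_r|exact: tame_r|by apply: tameZ; exact: tameD|].
move=> z; rewrite -mulrBr normrM ger0_norm//.
by rewrite ler_pM// window_shift_dist// ltW.
Qed.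

Lemma velocity_lipschitz t x y :
  `|velocity t x - velocity t y| <= L * (2 * rmax / eta) * `|x - y|.
Proof.
by rewrite (le_trans (vh_lipschitz _ _))// -mulrA ler_wpM2l// averaged_lipschitz.
Qed.

Lemma velocity_continuous t : continuous (velocity t).
Proof. exact: lipschitz_continuous (velocity_lipschitz t). Qed.

Lemma velocity_averaged t x : `|velocity t x - vbar| <= L * `|averaged t x - rhobar|.
Proof. by rewrite -vh_rhobar; exact: vh_lipschitz. Qed.

Lemma velocity_bound t x : `|velocity t x - vbar| <= L * rmax.
Proof.
rewrite (le_trans (velocity_averaged t x))// ler_wpM2l//.
by have := averaged_bound t x; have := rhobar_bound; rewrite ler_norml; lra.
Qed.

Let tame_r_dist s t N : tame (fun x => `|r s x - r t x| * window (- N) N x).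
Proof.
apply: (@tameM _ _ _ (rmax + rmax)); last exact: tame_window.
  by apply: measurableT_comp => //; apply: measurable_funB; exact: (field_measurable r_field).
move=> x; rewrite normr_id (le_trans (ler_normB _ _))//.
by apply: lerD; exact: (field_bound r_field).
Qed.

Lemma averaged_time_dist s t x N : `|x| <= N ->
  `|averaged s x - averaged t x| <=
    eta^-1 * intR (fun y => `|r s y - r t y| * window (- (N + eta)) (N + eta) y).
Proof.
move=> xN; rewrite /averaged -mulrBr normrM ger0_norm ?invr_ge0 ?(ltW eta0)//.
rewrite ler_wpM2l ?invr_ge0 ?(ltW eta0)//.
apply: le_dist_intR; [by apply: tame_r; exact: tame_window
  |by apply: tame_r; exact: tame_window|exact: tame_r_dist|].
move=> y; rewrite -mulrBl normrM (ger0_norm (window_ge0 _ _ _)) ler_wpM2l//.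
have eta_gt0 := eta0.
by apply: window_sub; move: xN; rewrite ler_norml; lra.
Qed.

Lemma relative_flow_field : L1loc_field (rmax * (L * rmax)) relative_flow.
Proof.
have mV t : measurable_fun setT (fun x => velocity t x - vbar).
  apply: continuous_measurable_fun => x.
  by apply: cvgB; [exact: velocity_continuous|exact: cvg_cst].
have LR0 : 0 <= L * rmax by rewrite mulr_ge0// ltW.
split=> [t|t x|t N e e0].
- by apply: measurable_funM; [exact: (field_measurable r_field)|exact: mV].
- rewrite normrM ler_pM ?velocity_bound//; exact: (field_bound r_field).
have [N0|N0] := ltP N 0.
  near=> s; rewrite (_ : intR _ = 0) ?(ltW e0)//.
  rewrite -[RHS](mul0r (intR (window 0 0))) -intRZ; last exact: tame_window.
  apply: eq_intR => x; rewrite mul0r window_out ?mulr0//; apply/negP; lra.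
pose c1 := L * rmax.
pose c2 := rmax * (L * eta^-1) * (N + N).
have c20 : 0 <= c2.
  have h1 := ltW rmax0; have h2 : 0 <= eta^-1 by rewrite invr_ge0 ltW.
  by rewrite /c2; nonneg.
pose e1 := e / (c1 + c2 + 1).
have cc0 : 0 < c1 + c2 + 1 by rewrite ltr_wpDl// addr_ge0.
have e10 : 0 < e1 by rewrite divr_gt0.
pose J s M := intR (fun x => `|r s x - r t x| * window (- M) M x).
near=> s.
have I1 : J s N <= e1 by near: s; exact: (field_continuous r_field).
have I2 : J s (N + eta) <= e1 by near: s; exact: (field_continuous r_field).
have tw : tame (fun x => rmax * (L * (eta^-1 * J s (N + eta))) * window (- N) N x).
  by apply: tameZ; exact: tame_window.
have t1 : tame (fun x => c1 * (`|r s x - r t x| * window (- N) N x)) by exact: tameZ.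
have NN : - N <= N by lra.
apply: (@le_trans _ _ (c1 * J s N + rmax * (L * (eta^-1 * J s (N + eta))) * (N - - N))).
  rewrite -(intR_window NN) -(intRZ _ (tame_window _ _)) -(intRZ _ (tame_r_dist s t N)).
  rewrite -intRD//.
  apply: le_intR; [|exact: tameD|].
    apply: (@tameM _ _ _ (rmax * (L * rmax) + rmax * (L * rmax))); last exact: tame_window.
      apply: measurableT_comp => //.
      by apply: measurable_funB; apply: measurable_funM; (exact: mV || exact: (field_measurable r_field)).
    move=> x; rewrite normr_id (le_trans (ler_normB _ _))//.
    by apply: lerD; rewrite normrM ler_pM ?velocity_bound//; exact: (field_bound r_field).
  move=> x; have [xN|xN] := boolP (- N <= x <= N); last first.
    by rewrite !(@window_out _ (- N))// !mulr0 addr0.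
  rewrite window_in// !mulr1 /relative_flow.
  rewrite (_ : _ - _ = (velocity s x - vbar) * (r s x - r t x)
     + r t x * (velocity s x - velocity t x)); last by ring.
  rewrite (le_trans (ler_normD _ _))// !normrM lerD//.
    by rewrite ler_wpM2r// velocity_bound.
  apply: ler_pM => //; first exact: (field_bound r_field).
  rewrite (le_trans (vh_lipschitz _ _))// ler_wpM2l//.
  by apply: averaged_time_dist; rewrite ler_norml.
apply: (@le_trans _ _ (c1 * e1 + c2 * e1)).
  apply: lerD; first by rewrite ler_wpM2l.
  rewrite opprK (_ : _ * (N + N) = c2 * J s (N + eta)); last by rewrite /c2; ring.
  by rewrite ler_wpM2l.
rewrite -mulrDl /e1 mulrA ler_pdivrMr// mulrC ler_wpM2l ?(ltW e0)//; lra.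
Unshelve. all: by end_near. Qed.

Let tame_bump' e t y : 0 < e -> tame (fun x => bump e (x - front t - y)).
Proof.
move=> e0; rewrite (_ : (fun x => _) = (fun x => bump e (x - (front t + y)))).
  exact: tame_bump.
by apply/funext => x; congr bump; ring.
Qed.

Let intR_bump' e t y : 0 < e -> intR (fun x => bump e (x - front t - y)) = 1.
Proof.
move=> e0; rewrite -(intR_bump e0 (front t + y)).
by apply: eq_intR => x; congr bump; ring.
Qed.

Let tame_flow t f : tame f -> tame (fun x => relative_flow t x * f x).
Proof. exact: (tame_field_mul t relative_flow_field). Qed.

Lemma pairing_bump_bound e t y : 0 < e ->
  rmin <= pairing r (fun z => bump e (z - y)) t <= rmax.
Proof.
move=> e0; have tb := tame_bump' t y e0.
rewrite -[X in X <= _]mulr1 -[X in _ <= _ <= X]mulr1 -(intR_bump' t y e0) -!intRZ//.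
have b0 x := bump_ge0 e0 (x - front t - y).
apply/andP; split; apply: le_intR => [||x].
- exact: tameZ.
- exact: tame_r.
- by rewrite ler_wpM2r.
- exact: tame_r.
- exact: tameZ.
- by rewrite ler_wpM2r.
Qed.

(** V is Lipschitz in x, so on the support of the kernel it can be frozen
at y at the cost of O(e).  This is the transport equation for the mass. *)
Lemma pairing_flow_bump e t y : 0 < e ->
  `|pairing relative_flow (fun z => bump e (z - y)) t
    - (velocity t (front t + y) - vbar) * pairing r (fun z => bump e (z - y)) t|
  <= rmax * (L * (2 * rmax / eta) * 2) * e.
Proof.
move=> e0; have tb := tame_bump' t y e0.
rewrite /pairing -intRZ; last exact: tame_r.
rewrite -[leRHS]mulr1 -[X in _ <= _ * X](intR_bump' t y e0) -intRZ//.
apply: le_dist_intR; [exact: tame_flow|by apply: tameZ; exact: tame_r|exact: tameZ|].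
move=> x; rewrite /relative_flow.
set c := velocity t (front t + y).
rewrite (_ : _ - _ = r t x * (velocity t x - c) * bump e (x - front t - y)); last by ring.
rewrite normrM (ger0_norm (bump_ge0 e0 _)).
have [H|H] := boolP (0 <= x - front t - y <= 2 * e); last by rewrite (bump_out e0 H) !mulr0.
rewrite ler_wpM2r ?bump_ge0// normrM -mulrA.
apply: ler_pM => //; first by rewrite ger0_norm.
rewrite (le_trans (velocity_lipschitz _ _ _))//.
rewrite [leRHS](_ : _ = L * (2 * rmax / eta) * (2 * e)); last by ring.
rewrite ler_wpM2l//.
  by rewrite mulr_ge0 ?divr_ge0 ?mulr_ge0 ?(ltW rmax0) ?(ltW eta0).
by move: H; rewrite ler_norml; have := e0; lra.
Qed.

Let shift_sub x t y : x - front t - y = x - (front t + y).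
Proof. by ring. Qed.

Let tame_ramp e t p q : 0 < e ->
  tame (fun x => ramp e (x - front t - p) - ramp e (x - front t - q)).
Proof. by move=> e0; exact: (tame_kernel_shift _ (ramp_kernel e0 p q)). Qed.

Lemma pairing_ramp_window e t p q : 0 < e -> p <= q ->
  `|pairing r (fun z => ramp e (z - p) - ramp e (z - q)) t
    - intR (fun x => r t x * window (front t + p) (front t + q) x)| <= 4 * rmax * e.
Proof.
move=> e0 pq.
have w0 a : a <= a + 2 * e by rewrite lerDl mulr_ge0 // ltW.
rewrite (_ : 4 * rmax * e = rmax * ((front t + p + 2 * e - (front t + p))
   + (front t + q + 2 * e - (front t + q)))); last by ring.
rewrite -(intR_window (w0 (front t + p))) -(intR_window (w0 (front t + q))).
have tw u v := tame_window (u : R) v.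
rewrite -intRD// -intRZ; last exact: tameD.
apply: le_dist_intR.
- by apply: tame_r; exact: tame_ramp.
- exact: tame_r.
- by apply: tameZ; exact: tameD.
move=> x; rewrite -mulrBr normrM ler_pM ?(ger0_norm (r_ge0 _ _))// !shift_sub.
by apply: ramp_window_dist; rewrite ?lerD2l.
Qed.

Lemma pairing_ramp_bound e t p q : 0 < e ->
  `|pairing r (fun z => ramp e (z - p) - ramp e (z - q)) t| <= rmax * (`|p - q| + 2 * e).
Proof.
move=> e0.
have mM : Num.min (front t + p) (front t + q) <= Num.max (front t + p) (front t + q) + 2 * e.
  rewrite (@le_trans _ _ (front t + p)) ?ge_min ?lexx//.
  by rewrite (@le_trans _ _ (Num.max (front t + p) (front t + q))) ?le_max ?lexx// lerDl mulr_ge0// ltW.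
have -> : `|p - q| + 2 * e = Num.max (front t + p) (front t + q) + 2 * e
    - Num.min (front t + p) (front t + q).
  by case: (leP (front t + p)); rewrite ?lerD2l ?ltrD2l => pq;
    [rewrite distrC|]; rewrite ger0_norm ?subr_ge0 ?(ltW pq)//; ring.
rewrite -(intR_window mM) -intRZ; last exact: tame_window.
apply: le_norm_intR; [by apply: tame_r; exact: tame_ramp|by apply: tameZ; exact: tame_window|].
by move=> x; rewrite normrM ler_pM ?(ger0_norm (r_ge0 _ _))// !shift_sub ramp_diff_le.
Qed.

(** The mollified mass in the look-ahead interval recovers the nonlocal
average up to O(e). *)
Lemma pairing_ramp_averaged e t y : 0 < e ->
  `|eta^-1 * pairing r (fun z => ramp e (z - y) - ramp e (z - (y + eta))) t
    - averaged t (front t + y)| <= 4 * rmax / eta * e.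
Proof.
move=> e0; have yy : y <= y + eta by rewrite lerDl ltW.
have := pairing_ramp_window t e0 yy.
rewrite /averaged -mulrBr normrM ger0_norm ?invr_ge0 ?(ltW eta0)// addrA => H.
rewrite mulrC ler_pdivrMr// (le_trans H)//.
by rewrite [leRHS](_ : _ = 4 * rmax * e)//; field; rewrite gt_eqF.
Qed.

Hypothesis initial : forall f, tame f -> (forall x, x < b -> f x = 0) ->
  intR (fun x => r 0 x * f x) = rhobar * intR f.

Hypothesis balance : forall e y z, 0 < e -> forall t, 0 < t ->
  is_derive t 1 (pairing r (fun x => ramp e (x - y) - ramp e (x - z)))
    (pairing relative_flow (fun x => bump e (x - y) - bump e (x - z)) t).

Let front0 : front 0 = b.
Proof. by rewrite /front mulr0 addr0. Qed.

Let pairing_bumpB g (B : R) e y z t : L1loc_field B g -> 0 < e ->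
  pairing g (fun x => bump e (x - y) - bump e (x - z)) t =
  pairing g (fun x => bump e (x - y)) t - pairing g (fun x => bump e (x - z)) t.
Proof.
move=> fg e0; rewrite /pairing -intRB; first by apply: eq_intR => x; rewrite mulrBr.
- by apply: (tame_field_mul t fg); exact: tame_bump'.
- by apply: (tame_field_mul t fg); exact: tame_bump'.
Qed.

Let intR_ramp e p q : 0 < e -> p <= q ->
  `|intR (fun x => ramp e (x - b - p) - ramp e (x - b - q)) - (q - p)| <= 4 * e.
Proof.
move=> e0 pq.
have w0 a : a <= a + 2 * e by rewrite lerDl mulr_ge0 // ltW.
have tw u v := tame_window (u : R) v.
have bpq : b + p <= b + q by rewrite lerD2l.
rewrite (_ : q - p = b + q - (b + p)); last by ring.
rewrite -(intR_window bpq).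
rewrite (_ : 4 * e = (b + p + 2 * e - (b + p)) + (b + q + 2 * e - (b + q))); last by ring.
rewrite -(intR_window (w0 (b + p))) -(intR_window (w0 (b + q))) -intRD//.
apply: le_dist_intR => //; last first.
- by move=> x; rewrite -!(addrA x) -!opprD; exact: ramp_window_dist.
- exact: tameD.
- by rewrite -front0; exact: tame_ramp.
Qed.

Let pairing_flow_bound e t y : 0 < e ->
  `|pairing relative_flow (fun z => bump e (z - y)) t| <= rmax * (L * rmax).
Proof.
move=> e0; have tb := tame_bump' t y e0.
rewrite -[leRHS]mulr1 -[X in _ <= _ * X](intR_bump' t y e0) -intRZ//.
apply: le_norm_intR; [exact: tame_flow|exact: tameZ|].
move=> x; rewrite normrM (ger0_norm (bump_ge0 e0 _)) ler_wpM2r ?bump_ge0//.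
exact: (field_bound relative_flow_field).
Qed.

(** A constant dominating every bound that the maximum principle asks for up
to time T. *)
Definition mass_const (T : R) : R :=
  1 + 4 * rmax + rmax * (L * rmax) * (1 + T) + L * rmax
  + rmax * (L * (2 * rmax / eta) * 2) + L / eta + L * (4 * rmax / eta).

Section mass.
Variables (e : R) (F : R -> R).
Hypothesis e0 : 0 < e.
Hypothesis F_derive : forall t,
  is_derive t 1 F (pairing relative_flow (fun z => bump e (z - 0)) t).

(** The integral is the mass between the front and y; subtracting the time
integral of the flux through the front makes the t-derivative local at y. *)
Definition mass t y : R :=
  pairing r (fun z => ramp e (z - 0) - ramp e (z - y)) t - (F t - F 0).

Lemma mass_derive_t t y : 0 < t ->
  is_derive t 1 (mass ^~ y) (- pairing relative_flow (fun z => bump e (z - y)) t).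
Proof.
move=> t0; have d1 := balance 0 y e0 t0; have d2 := F_derive t.
rewrite (_ : mass ^~ y = pairing r (fun z => ramp e (z - 0) - ramp e (z - y)) - (F - cst (F 0)))//.
apply: is_derive_eq; rewrite (pairing_bumpB _ _ _ relative_flow_field)// subr0.
by ring.
Qed.

Lemma mass_derive_y t y :
  is_derive y 1 (mass t) (pairing r (fun z => bump e (z - y)) t).
Proof.
apply: (@local_quadratic_is_derive _ _ _ _ (2 / e ^+ 2 * (rmax * (2 * e + 2)))) => h h1.
have e_gt0 := e0.
have h1' : -1 <= h <= 1 by rewrite -ler_norml.
rewrite /mass (_ : _ - _ = (pairing r (fun z => ramp e (z - 0) - ramp e (z - (y + h))) t
  - pairing r (fun z => ramp e (z - 0) - ramp e (z - y)) t)
  - h * pairing r (fun z => bump e (z - y)) t); last by ring.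
rewrite /pairing -intRB; [|by apply: tame_r; exact: tame_ramp..].
rewrite -intRZ; last by apply: tame_r; exact: tame_bump'.
set a := front t + y - 1; set c := front t + y + 2 * e + 1.
have ac : a <= c by rewrite /a /c; lra.
rewrite (_ : 2 / e ^+ 2 * _ * _ = 2 / e ^+ 2 * h ^+ 2 * rmax * (c - a)); last first.
  by rewrite /a /c; ring.
rewrite -(intR_window ac) -intRZ; last exact: tame_window.
apply: le_dist_intR.
- by apply: tameB; apply: tame_r; exact: tame_ramp.
- by apply: tameZ; apply: tame_r; exact: tame_bump'.
- by apply: tameZ; exact: tame_window.
move=> x; set z := x - front t.
rewrite (_ : _ - _ = - (r t x * (ramp e (z - y + - h) - ramp e (z - y) - - h * bump e (z - y)))); last first.
  by rewrite [z - y - h](_ : _ = z - (y + h)); [ring|ring].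
rewrite normrN normrM (ger0_norm (r_ge0 _ _)).
have [xac|xac] := boolP (a <= x <= c).
  rewrite window_in// mulr1 mulrC ler_pM//.
  by rewrite (le_trans (ramp_taylor e0 _ _))// sqrrN.
rewrite window_out// mulr0 bump_out//; last first.
  by apply: contra xac; rewrite /a /c /z; lra.
rewrite mulr0 subr0; move: xac; rewrite negb_and -!ltNge /a /c => /orP[xa|xc].
  by rewrite !(ramp_left e0) ?subrr ?normr0 ?mulr0// /z; lra.
by rewrite !(ramp_right e0) ?subrr ?normr0 ?mulr0// /z; lra.
Qed.

Lemma mass_increment t y z :
  pairing r (fun x => ramp e (x - y) - ramp e (x - z)) t = mass t z - mass t y.
Proof.
rewrite /mass [RHS](_ : _ = pairing r (fun x => ramp e (x - 0) - ramp e (x - z)) t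
   - pairing r (fun x => ramp e (x - 0) - ramp e (x - y)) t); last by ring.
rewrite /pairing -intRB; [|by apply: tame_r; exact: tame_ramp..].
by apply: eq_intR => x; ring.
Qed.

Let FB := rmax * (L * rmax).

Let FB0 : 0 <= FB.
Proof. by rewrite /FB !mulr_ge0// ltW. Qed.

Lemma mass_dist_t s t y : 0 <= s <= t -> `|mass t y - mass s y| <= FB * (t - s).
Proof.
move=> /andP[s0 st]; apply: (@le_norm_is_derive _ (mass ^~ y)
  (fun x => - pairing relative_flow (fun z => bump e (z - y)) x) FB s t st).
- by move=> x /andP[sx _]; apply: mass_derive_t; exact: le_lt_trans sx.
- apply: continuous_subspaceT => x; apply: cvgB.
    exact: (pairing_continuous r_field (ramp_kernel e0 _ _)).
  by apply: cvgB; [exact: is_derive1_continuous (F_derive x)|exact: cvg_cst].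
- by move=> x _; rewrite normrN; exact: pairing_flow_bound.
Qed.

Lemma mass_dist_y t y z : `|mass t y - mass t z| <= rmax * `|y - z|.
Proof.
wlog yz : y z / z <= y.
  move=> H; have [/H//|/H] := orP (le_total z y).
  by rewrite distrC (distrC z).
rewrite (ger0_norm (_ : 0 <= y - z)) ?subr_ge0//.
apply: (@le_norm_is_derive _ (mass t)
  (fun x => pairing r (fun z => bump e (z - x)) t) rmax z y yz).
- by move=> x _; exact: mass_derive_y.
- by apply: continuous_subspaceT => x; exact: is_derive1_continuous (mass_derive_y t x).
- move=> x _; have /andP[h1 h2] := pairing_bump_bound t x e0.
  by rewrite ger0_norm// (le_trans rmin0).
Qed.

Lemma mass_lipschitz s t y z : 0 <= s -> 0 <= t ->
  `|mass s y - mass t z| <= (FB + rmax) * (`|s - t| + `|y - z|).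
Proof.
move=> s0 t0; rewrite (_ : mass s y - _ = (mass s y - mass t y) + (mass t y - mass t z)); last by ring.
rewrite (le_trans (ler_normD _ _))//.
have h1 : `|mass s y - mass t y| <= FB * `|s - t|.
  have [st|ts] := orP (le_total s t).
    rewrite distrC (distrC s) (ger0_norm (_ : 0 <= t - s)) ?subr_ge0//.
    by apply: mass_dist_t; rewrite s0.
  rewrite (ger0_norm (_ : 0 <= s - t)) ?subr_ge0//.
  by apply: mass_dist_t; rewrite t0.
have h2 := mass_dist_y t y z.
have h3 : 0 <= FB * `|y - z| by rewrite mulr_ge0.
have h4 : 0 <= rmax * `|s - t| by rewrite mulr_ge0// ltW.
by lra.
Qed.

Lemma mass_initial_left y : y <= 0 -> mass 0 y <= 0.
Proof.
move=> y0; rewrite /mass subrr subr0 /pairing.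
apply: (@le_trans _ _ (intR (cst 0))).
  apply: le_intR; [by apply: tame_r; exact: tame_ramp| |].
    by rewrite (_ : cst 0 = fun x => 0 * window 0 0 x); [apply: tameZ; exact: tame_window|apply/funext => x; rewrite mul0r].
  by move=> x; rewrite mulr_ge0_le0// subr_le0 ramp_nd//; lra.
by rewrite /intR Rintegral_cst// mul0r.
Qed.

Lemma mass_initial_right y : 0 <= y -> `|mass 0 y - rhobar * y| <= 4 * rmax * e.
Proof.
move=> y0; rewrite /mass subrr subr0 /pairing front0 initial; last first.
- move=> x xb; rewrite !(ramp_left e0) ?subrr//; lra.
- by rewrite -front0; exact: tame_ramp.
have /andP[h1 h2] := rhobar_bound.
have := intR_ramp e0 y0; rewrite subr0 => H.
rewrite -mulrBr normrM (ger0_norm (ltW h1)) (_ : 4 * _ * _ = rmax * (4 * e)); last by ring.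
by rewrite ler_pM// ltW.
Qed.

Lemma mass_barrier (T t y : R) : e <= 1 -> 0 <= t <= T ->
  pos (mass t y) ^+ 2 * (mass t y - rhobar * y) ^+ 2 * weight y <=
    barrier_const T (mass_const T) eta * e.
Proof.
move=> e1 tT; have T0 : 0 <= T by have /andP[t0] := tT; exact: le_trans.
have R0 := ltW rmax0; have /andP[rb0 rb1] := rhobar_bound.
pose C := mass_const T.
have FBT : 0 <= FB * T by rewrite mulr_ge0.
have c1 : 0 <= L * rmax by rewrite mulr_ge0.
have c2 : 0 <= rmax * (L * (2 * rmax / eta) * 2).
  by rewrite !mulr_ge0 ?invr_ge0 ?(ltW eta0).
have c3 : 0 <= L / eta by rewrite divr_ge0// ltW.
have c4 : 0 <= L * (4 * rmax / eta) by rewrite !mulr_ge0 ?invr_ge0 ?(ltW eta0).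
have CE : C = 1 + 4 * rmax + (FB + FB * T) + L * rmax
  + rmax * (L * (2 * rmax / eta) * 2) + L / eta + L * (4 * rmax / eta).
  by rewrite /C /mass_const /FB; ring.
have FB_ge0 := FB0.
have C1 : 1 <= C by rewrite CE; lra.
apply: (@front_barrier _ T C rhobar eta e mass
  (fun t y => - pairing relative_flow (fun z => bump e (z - y)) t)
  (fun t y => pairing r (fun z => bump e (z - y)) t)
  (fun t y => velocity t (front t + y) - vbar)).
- exact: T0.
- exact: C1.
- by rewrite (ltW rb0) CE; lra.
- exact: (ltW eta0).
- exact: e0.
- exact: e1.
- by move=> ? ?; exact: mass_derive_t.
- by move=> ? ? _; exact: mass_derive_y.
- move=> s u y1 z1 s0 u0; rewrite (le_trans (mass_lipschitz _ _ s0 u0))//.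
  by rewrite ler_wpM2r ?addr_ge0// CE; lra.
- move=> u y1 /andP[u0 uT].
  have h1 : `|mass u y1 - mass 0 y1| <= FB * T.
    have u00 : (0 : R) <= 0 <= u by rewrite lexx u0.
    by rewrite (le_trans (mass_dist_t y1 u00))// subr0 ler_wpM2l.
  have h2 : `|mass 0 y1| <= rmax * (`|y1| + 2).
    rewrite /mass subrr subr0 (le_trans (pairing_ramp_bound _ _ _ e0))//.
    by rewrite sub0r normrN ler_wpM2l// lerD2l ler_piMr.
  have := ler_normD (mass u y1 - mass 0 y1) (mass 0 y1); rewrite subrK.
  have h3 : 0 <= (C - rmax) * `|y1| by rewrite mulr_ge0// CE; lra.
  have h4 : 2 * rmax + FB * T <= C by rewrite CE; lra.
  by lra.
- move=> u y1 _; have /andP[h1 _] := pairing_bump_bound u y1 e0.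
  exact: le_trans h1.
- move=> u y1 _; rewrite -normrN opprD opprK.
  rewrite (le_trans (pairing_flow_bump _ _ e0))// ler_wpM2r ?(ltW e0)//.
  by rewrite CE; lra.
- move=> u y1 _; rewrite (le_trans (velocity_bound _ _))// CE; lra.
- move=> u y1 _; rewrite (le_trans (velocity_averaged _ _))//.
  have H := pairing_ramp_averaged u y1 e0.
  set D1 := mass u (y1 + eta) - _; set D0 := mass u y1 - _.
  set p := pairing r _ u in H.
  have ED : p = D1 - D0 + rhobar * eta.
    by rewrite /p mass_increment /D1 /D0; ring.
  have eta_inv : 0 < eta^-1 by rewrite invr_gt0.
  have H2 : `|averaged u (front u + y1) - rhobar| <= eta^-1 * (`|D1| + `|D0|) + 4 * rmax / eta * e.
    have -> : averaged u (front u + y1) - rhobar =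
      eta^-1 * (D1 - D0) - (eta^-1 * p - averaged u (front u + y1)).
      by rewrite ED; field; rewrite gt_eqF.
    rewrite (le_trans (ler_normB _ _))// lerD// normrM (ger0_norm (ltW eta_inv)).
    by rewrite ler_pM2l// ler_normB.
  have H3 := ler_wpM2l L0 H2; apply: (le_trans H3).
  rewrite mulrDr !mulrA lerD//.
    by rewrite ler_wpM2r ?addr_ge0// CE; lra.
  by rewrite ler_wpM2r ?(ltW e0)// -!mulrA !(mulrA 4) CE; lra.
- move=> y1; have [y0|y0] := leP y1 0; first by left; exact: mass_initial_left.
  right; rewrite (le_trans (mass_initial_right (ltW y0)))// ler_wpM2r ?(ltW e0)//.
  by rewrite CE; lra.
- exact: tT.
Qed.
End mass.

Let mass_exists e : 0 < e -> exists F : R -> R, forall t,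
  is_derive t 1 F (pairing relative_flow (fun z => bump e (z - 0)) t).
Proof.
move=> e0; apply: primitive_exists.
exact: (pairing_continuous relative_flow_field (single_bump_kernel e0 0)).
Qed.

(** At a point where m = (rhobar / 2) y with y >= y1 both factors of the
barrier function equal ((rhobar / 2) y)^2, which is too large for small e.  Far
to the right m exceeds this line by finite speed of propagation, so by
continuity it stays above it down to y1. *)
Lemma mass_above_half (t y1 Y e : R) (F : R -> R) :
  0 < e <= 1 -> 0 <= t -> 0 < y1 <= Y ->
  (forall t, is_derive t 1 F (pairing relative_flow (fun z => bump e (z - 0)) t)) ->
  4 * rmax + rmax * (L * rmax) * t < rhobar / 2 * Y ->
  barrier_const t (mass_const t) eta * e < ((rhobar / 2 * y1) ^+ 2) ^+ 2 * weight Y ->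
  forall y, y1 <= y <= Y -> rhobar / 2 * y < mass e F t y.
Proof.
move=> /andP[e0 e1] t0 /andP[y10 y1Y] dF HY He y /andP[y1y yY].
have /andP[rb0 rb1] := rhobar_bound.
have h0 : 0 < rhobar / 2 by rewrite divr_gt0.
have top : rhobar / 2 * Y < mass e F t Y.
  have Y0 : 0 <= Y by lra.
  have i0 := mass_initial_right F e0 Y0.
  have t00 : (0 : R) <= 0 <= t by rewrite lexx t0.
  have i1 := mass_dist_t e0 dF Y t00.
  have i2 : 4 * rmax * e <= 4 * rmax by rewrite ler_piMr// mulr_ge0// ltW.
  by move: i0 i1; rewrite subr0 !ler_norml; lra.
rewrite ltNge; apply/negP => low.
pose f z := mass e F t z - rhobar / 2 * z.
have cf : continuous f.
  move=> z; apply: cvgB; first exact: is_derive1_continuous (mass_derive_y F e0 t z).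
  by apply: cvgM; [exact: cvg_cst|exact: cvg_id].
have [|z zyY fz] := IVT yY (@continuous_subspaceT _ _ `[y, Y]%classic f cf) (v := 0).
  rewrite /f ge_min le_max; apply/andP; split; apply/orP; [left|right]; lra.
have mz : mass e F t z = rhobar / 2 * z by apply/eqP; rewrite -subr_eq0; apply/eqP.
move: zyY; rewrite in_itv /= => /andP[yz zY].
have z0 : 0 < z by lra.
have mz0 : 0 <= rhobar / 2 * z by rewrite mulr_ge0// ltW.
have tt : 0 <= t <= t by rewrite t0 lexx.
have := mass_barrier e0 dF z e1 tt; rewrite leNgt => /negP; apply.
apply: (lt_le_trans He); rewrite mz /pos max_r//.
rewrite (_ : rhobar / 2 * z - rhobar * z = - (rhobar / 2 * z)); last by field.
have nn : 0 <= rhobar / 2 * y1 by rewrite mulr_ge0// ltW.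
have nz : rhobar / 2 * y1 <= rhobar / 2 * z.
  by rewrite ler_wpM2l ?(ltW h0)//; lra.
have nz2 : (rhobar / 2 * y1) ^+ 2 <= (rhobar / 2 * z) ^+ 2 by rewrite lerXn2r ?nnegrE.
have wz : weight Y <= weight z by apply: weight_nonincreasing; rewrite (ltW z0).
rewrite sqrrN -(expr2 ((rhobar / 2 * z) ^+ 2)).
apply: ler_pM wz; [exact: sqr_ge0|exact: ltW (weight_gt0 _)|].
by rewrite lerXn2r ?nnegrE ?sqr_ge0.
Qed.

(** On [y1, y1 + eta] the mass is bounded below, so the barrier bound forces
D to be small at both ends of the averaging window; W - rhobar is the
difference of these two values divided by eta, up to O(e). *)
Lemma averaged_right_of_front t y : 0 < t -> 0 <= y ->
  averaged t (front t + y) = rhobar.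
Proof.
move=> t0; have /andP[rb0 rb1] := rhobar_bound.
suff Hpos y1 : 0 < y1 -> averaged t (front t + y1) = rhobar.
  rewrite le_eqVlt => /predU1P[<-|/Hpos//].
  apply/eqP; rewrite -subr_eq0 -normr_le0; apply/ler_addgt0Pl => k k0; rewrite !addr0.
  pose c := 2 * rmax / eta.
  have c0 : 0 < c by rewrite divr_gt0// mulr_gt0.
  have kc : 0 < k / c by rewrite divr_gt0.
  rewrite -(Hpos _ kc); apply: (le_trans (averaged_lipschitz _ _ _)).
  rewrite (_ : _ - _ = - (k / c)); last by ring.
  rewrite normrN (ger0_norm (ltW kc)) [leLHS](_ : _ = k)// /c.
  by field; rewrite !gt_eqF.
move=> {y} y10.
have h0 : 0 < rhobar / 2 by rewrite divr_gt0.
(* Large enough for the far-right bound on the mass, whatever e <= 1. *)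
pose Y := y1 + eta + (4 * rmax + rmax * (L * rmax) * t + 1) / (rhobar / 2).
have FB0 : 0 <= rmax * (L * rmax) * t.
  by rewrite !mulr_ge0 ?(ltW rmax0) ?L0 ?(ltW t0).
have num0 : 0 < 4 * rmax + rmax * (L * rmax) * t + 1 by have := rmax0; lra.
have q0 : 0 < (4 * rmax + rmax * (L * rmax) * t + 1) / (rhobar / 2) by rewrite divr_gt0.
have HY : 4 * rmax + rmax * (L * rmax) * t < rhobar / 2 * Y.
  rewrite /Y mulrDr [rhobar / 2 * (_ / _)]mulrC divfK ?gt_eqF//.
  have : 0 < rhobar / 2 * (y1 + eta) by rewrite mulr_gt0// addr_gt0.
  by lra.
have y1Y : y1 + eta <= Y by rewrite /Y; lra.
have y1Y' : y1 <= Y by have := eta0; lra.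
pose q := (rhobar / 2 * y1) ^+ 2.
have q00 : 0 < q by rewrite /q exprn_gt0// mulr_gt0.
have w0 := weight_gt0 Y.
pose Cb := barrier_const t (mass_const t) eta.
apply/eqP; rewrite -subr_eq0 -normr_le0; apply/ler_addgt0Pl => k k0; rewrite addr0.
pose k1 := k * eta / 4.
have k10 : 0 < k1 by rewrite divr_gt0// mulr_gt0.
near (0 : R)^'+ => e.
have e0 : 0 < e by near: e; exact: nbhs_right_gt.
have e1 : e <= 1 by near: e; exact: nbhs_right_le.
have s1 : Cb * e <= q ^+ 2 * weight Y / 2.
  by near: e; apply: near_small; rewrite divr_gt0// mulr_gt0// exprn_gt0.
have s2 : Cb * e <= q * k1 ^+ 2 * weight Y.
  by near: e; apply: near_small; rewrite !mulr_gt0// exprn_gt0.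
have s3 : 4 * rmax / eta * e <= k / 2.
  by near: e; apply: near_small; rewrite divr_gt0.
have [F dF] := mass_exists e0.
have e01 : 0 < e <= 1 by rewrite e0.
have y10Y : 0 < y1 <= Y by rewrite y10.
have He : Cb * e < q ^+ 2 * weight Y.
  have : 0 < q ^+ 2 * weight Y by rewrite mulr_gt0// exprn_gt0.
  by lra.
have half := mass_above_half e01 (ltW t0) y10Y dF HY He.
have D_small y : y1 <= y <= Y -> `|mass e F t y - rhobar * y| <= k1.
  move=> yY; have my := half y yY; move/andP: (yY) => [y1y yY'].
  have tt : 0 <= t <= t by rewrite (ltW t0) lexx.
  have B := mass_barrier e0 dF y e1 tt.
  have hy : rhobar / 2 * y1 <= mass e F t y.
    by rewrite (le_trans _ (ltW my))// ler_wpM2l// ltW.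
  have hy0 : 0 <= rhobar / 2 * y1 by rewrite mulr_ge0// ltW.
  have pm : pos (mass e F t y) = mass e F t y by rewrite /pos max_r// (le_trans hy0).
  have wy : weight Y <= weight y.
    by apply: weight_nonincreasing; rewrite yY' (le_trans (ltW y10)).
  have : q * (mass e F t y - rhobar * y) ^+ 2 * weight Y <= q * k1 ^+ 2 * weight Y.
    apply: le_trans s2; apply: le_trans B; rewrite pm.
    have q_le : q <= mass e F t y ^+ 2 by rewrite lerXn2r ?nnegrE// (le_trans hy0).
    apply: ler_pM wy; [by rewrite mulr_ge0 ?sqr_ge0|exact: ltW|].
    by rewrite ler_wpM2r ?sqr_ge0.
  rewrite ler_pM2r// ler_pM2l// -(real_normK (num_real (_ - _))).
  by rewrite ler_pXn2r ?nnegrE// ltW.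
have d1 : `|mass e F t y1 - rhobar * y1| <= k1 by apply: D_small; rewrite lexx.
have d2 : `|mass e F t (y1 + eta) - rhobar * (y1 + eta)| <= k1.
  by apply: D_small; rewrite y1Y lerDl ltW.
have H := pairing_ramp_averaged t y1 e0.
set p := pairing r _ t in H.
have ED : p = (mass e F t (y1 + eta) - rhobar * (y1 + eta))
   - (mass e F t y1 - rhobar * y1) + rhobar * eta.
  by rewrite /p (mass_increment F e0); ring.
have eta_inv : 0 < eta^-1 by rewrite invr_gt0.
have -> : averaged t (front t + y1) - rhobar = eta^-1 * (p - rhobar * eta)
   - (eta^-1 * p - averaged t (front t + y1)).
  by field; rewrite gt_eqF.
rewrite (le_trans (ler_normB _ _))//.
have : `|eta^-1 * (p - rhobar * eta)| <= k / 2.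
  rewrite normrM (ger0_norm (ltW eta_inv)) ler_pdivrMl// ED addrK.
  rewrite (le_trans (ler_normB _ _))// (le_trans (lerD d2 d1))// /k1; lra.
by move: H s3; lra.
Unshelve. all: by end_near. Qed.

Let velocity_right_of_front t x : 0 < t -> front t <= x -> velocity t x = vbar.
Proof.
move=> t0 tx; rewrite /velocity (_ : x = front t + (x - front t)); last by ring.
by rewrite averaged_right_of_front ?subr_ge0.
Qed.

Let pairing_flow_right e t y : 0 < e -> 0 < t -> 0 <= y ->
  pairing relative_flow (fun z => bump e (z - y)) t = 0.
Proof.
move=> e0 t0 y0; rewrite /pairing -[RHS](mul0r (intR (window 0 0))).
rewrite -intRZ; last exact: tame_window.
apply: eq_intR => x; rewrite mul0r; have [tx|xt] := leP (front t) x.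
  by rewrite /relative_flow velocity_right_of_front// subrr mulr0 mul0r.
by rewrite (bump_out e0) ?mulr0//; apply/negP; lra.
Qed.

Let smooth_averaged e y t :=
  eta^-1 * pairing r (fun z => ramp e (z - y) - ramp e (z - (y + eta))) t.

Let deviation e y t := vh (smooth_averaged e y t) - vbar.

Let decay_rate := - (2 / eta * lmax * rmin).

Let deviation_derive e y t : 0 < e -> 0 < t -> - eta <= y ->
  is_derive t 1 (deviation e y)
    (dvh (smooth_averaged e y t) *
      (eta^-1 * pairing relative_flow (fun z => bump e (z - y)) t)).
Proof.
move=> e0 t0 y_eta; have d1 := balance y (y + eta) e0 t0.
rewrite (pairing_bumpB _ _ _ relative_flow_field)// in d1.
rewrite (pairing_flow_right e0 t0 (_ : 0 <= y + eta)) ?subr0 in d1; last by lra.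
have d2 : is_derive t 1 (smooth_averaged e y)
   (eta^-1 * pairing relative_flow (fun z => bump e (z - y)) t).
  rewrite (_ : smooth_averaged e y = cst eta^-1 *
    pairing r (fun z => ramp e (z - y) - ramp e (z - (y + eta))))//.
  by apply: is_derive_eq; rewrite /GRing.scale /=; ring.
have d3 := is_derive1_comp (vh_derive (smooth_averaged e y t)) d2.
rewrite (_ : deviation e y = (vh \o smooth_averaged e y) - cst vbar)//.
by apply: is_derive_eq; rewrite subr0.
Qed.

Let deviation_near e y t : 0 < e ->
  `|deviation e y t - (velocity t (front t + y) - vbar)| <= L * (4 * rmax / eta) * e.
Proof.
move=> e0; rewrite (_ : _ - _ = vh (smooth_averaged e y t) - velocity t (front t + y)); last first.
  by rewrite /deviation; ring.
rewrite (le_trans (vh_lipschitz _ _))// -[leRHS]mulrA ler_wpM2l//.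
exact: pairing_ramp_averaged.
Qed.

Let deviation_bound e y t : 0 < e <= 1 ->
  `|deviation e y t| <= L * (4 * rmax / eta) + L * rmax.
Proof.
move=> /andP[e0 e1]; have h1 := deviation_near y t e0.
have h2 := velocity_bound t (front t + y).
have h3 : L * (4 * rmax / eta) * e <= L * (4 * rmax / eta).
  by rewrite ler_piMr// !mulr_ge0 ?invr_ge0 ?(ltW eta0) ?(ltW rmax0).
have := ler_normD (deviation e y t - (velocity t (front t + y) - vbar))
  (velocity t (front t + y) - vbar); rewrite subrK.
by lra.
Qed.

(** The size of the error made by freezing the velocity and mollifying the
average, in the differential inequality for the squared deviation. *)
Let decay_error :=
  2 / eta * L * ((L * (4 * rmax / eta) + L * rmax) *
    (L * (4 * rmax / eta) * rmax + rmax * (L * (2 * rmax / eta) * 2))).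

Let decay_rate_ge0 : 0 <= decay_rate.
Proof.
rewrite /decay_rate oppr_ge0 mulr_le0_ge0// mulr_ge0_le0 ?divr_ge0 ?(ltW eta0)//.
exact: ltW.
Qed.

Let decay_error_ge0 : 0 <= decay_error.
Proof.
have h1 := ltW rmax0; have h2 : 0 <= eta^-1 by rewrite invr_ge0 ltW.
have h3 := L0; rewrite /decay_error; nonneg.
Qed.

Let deviation_dissipates e y t : 0 < e <= 1 -> 0 < t ->
  2 * deviation e y t * (dvh (smooth_averaged e y t) *
      (eta^-1 * pairing relative_flow (fun z => bump e (z - y)) t)) <=
  - decay_rate * deviation e y t ^+ 2 + decay_error * e.
Proof.
move=> e01 t0; have /andP[e0 e1] := e01.
set E := deviation e y t; set dv := dvh _; set p := pairing relative_flow _ t.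
set n := pairing r (fun z => bump e (z - y)) t.
set c := velocity t (front t + y) - vbar.
have /andP[n_ge n_le] : rmin <= n <= rmax by exact: pairing_bump_bound.
have pcn : `|p - c * n| <= rmax * (L * (2 * rmax / eta) * 2) * e by exact: pairing_flow_bump.
have Ec : `|E - c| <= L * (4 * rmax / eta) * e by exact: deviation_near.
have Eb : `|E| <= L * (4 * rmax / eta) + L * rmax by exact: deviation_bound.
have n0 : 0 <= n by exact: le_trans n_ge.
pose err := (c - E) * n + (p - c * n).
have err_le : `|err| <= (L * (4 * rmax / eta) * rmax + rmax * (L * (2 * rmax / eta) * 2)) * e.
  rewrite (le_trans (ler_normD _ _))// [leRHS]mulrDl lerD// normrM (ger0_norm n0) distrC.
  rewrite [leRHS](_ : _ = L * (4 * rmax / eta) * e * rmax); last by ring.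
  by rewrite ler_pM.
have dvL : `|dv| <= L.
  by rewrite ler_norml dvh_ge /= ; have := dvh_le (smooth_averaged e y t); have := lmax0; have := L0; rewrite -/dv; lra.
have i0 : 0 <= 2 / eta by rewrite divr_ge0// ltW.
rewrite (_ : 2 * E * _ = 2 / eta * (dv * n * E ^+ 2) + 2 / eta * (dv * (E * err))); last first.
  by rewrite /err; field; rewrite gt_eqF.
apply: lerD.
  rewrite /decay_rate opprK [leRHS](_ : _ = 2 / eta * (lmax * rmin * E ^+ 2)); last by ring.
  rewrite ler_wpM2l// ler_wpM2r ?sqr_ge0//.
  apply: (@le_trans _ _ (lmax * n)); first by rewrite ler_wpM2r// dvh_le.
  by rewrite ler_wnM2l// ltW.
rewrite (_ : decay_error * e = 2 / eta * (L * ((L * (4 * rmax / eta) + L * rmax) *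
  ((L * (4 * rmax / eta) * rmax + rmax * (L * (2 * rmax / eta) * 2)) * e)))); last first.
  by rewrite /decay_error; ring.
rewrite ler_wpM2l// (le_trans (ler_norm _))// !normrM.
by apply: ler_pM => //; exact: ler_pM.
Qed.

Let deviation_decay e y t : 0 < e <= 1 -> 0 <= t -> - eta <= y ->
  expR (decay_rate * t) * deviation e y t ^+ 2 <=
  deviation e y 0 ^+ 2 + expR (decay_rate * t) * decay_error * e * t.
Proof.
move=> e01 t0 y_eta; have /andP[e0 e1] := e01.
pose h s := expR (decay_rate * s) * deviation e y s ^+ 2.
pose dh s := expR (decay_rate * s) * (decay_rate * deviation e y s ^+ 2 +
  2 * deviation e y s * (dvh (smooth_averaged e y s) *
      (eta^-1 * pairing relative_flow (fun z => bump e (z - y)) s))).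
have ch : {within `[0, t], continuous h}.
  apply: continuous_subspaceT => s.
  have cdev : {for s, continuous (deviation e y)}.
    apply: cvgB; last exact: cvg_cst.
    apply: (@continuous_comp _ _ _ (smooth_averaged e y) vh).
      by apply: cvgM; [exact: cvg_cst|exact: (pairing_continuous r_field (ramp_kernel e0 _ _))].
    exact: is_derive1_continuous (vh_derive _).
  apply: cvgM; last by rewrite expr2; apply: cvgM; exact: cdev.
  apply: (@continuous_comp _ _ _ (fun s : R => decay_rate * s) expR); last exact: continuous_expR.
  by apply: cvgM; [exact: cvg_cst|exact: cvg_id].
have dhh s : 0 < s < t -> is_derive s 1 h (dh s).
  move=> /andP[s0 _]; have d1 := deviation_derive e0 s0 y_eta.
  have d2 : is_derive s 1 (fun s => expR (decay_rate * s)) (decay_rate * expR (decay_rate * s)).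
    have dl : is_derive s 1 (fun s : R => decay_rate * s) decay_rate.
      by apply: is_derive_eq; rewrite /GRing.scale /= ; ring.
    by have := is_derive1_comp (is_derive_expR (decay_rate * s)) dl; rewrite mulrC.
  rewrite (_ : h = (fun s => expR (decay_rate * s)) * (deviation e y) ^+ 2)//.
  by apply: is_derive_eq; rewrite /GRing.scale /= !fctE /dh; ring.
have dh_le s : 0 < s < t -> dh s <= expR (decay_rate * t) * decay_error * e.
  move=> /andP[s0 st].
  apply: (@le_trans _ _ (expR (decay_rate * s) * (decay_error * e))).
    rewrite ler_wpM2l ?expR_ge0//.
    by have := deviation_dissipates y e01 s0; lra.
  have de0 : 0 <= decay_error * e by rewrite (mulr_ge0 decay_error_ge0)// ltW.
  rewrite -[leRHS]mulrA; apply: ler_wpM2r de0 _ _ _.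
  by rewrite ler_expR ler_wpM2l// ltW.
have := le_is_derive t0 dhh ch dh_le.
by rewrite /h mulr0 expR0 mul1r subr0; lra.
Qed.

(** The differential inequality is integrated for the mollified average,
whose derivative in t exists; the bound is then passed to the limit e -> 0. *)
Lemma velocity_decay t y : 0 <= t -> - eta <= y ->
  (velocity t (front t + y) - vbar) ^+ 2 <=
    (velocity 0 (b + y) - vbar) ^+ 2 * expR (2 / eta * lmax * rmin * t).
Proof.
move=> t0 y_eta.
have -> : 2 / eta * lmax * rmin * t = - (decay_rate * t) by rewrite /decay_rate; ring.
have by0 : b + y = front 0 + y by rewrite front0.
rewrite expRN ler_pdivlMr ?expR_gt0// mulrC by0.
set X := expR _; pose c s := velocity s (front s + y) - vbar.
have X0 : 0 <= X by exact: expR_ge0.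
pose K0 := L * (4 * rmax / eta).
pose B := K0 + L * rmax + L * rmax.
apply/ler_addgt0Pl => k k0.
have K00 : 0 <= K0 by rewrite /K0 !mulr_ge0 ?invr_ge0 ?(ltW eta0) ?(ltW rmax0).
near (0 : R)^'+ => e.
have e0 : 0 < e by near: e; exact: nbhs_right_gt.
have e1 : e <= 1 by near: e; exact: nbhs_right_le.
have s1 : (X * (K0 * B) + K0 * B + X * decay_error * t) * e <= k.
  by near: e; exact: near_small.
have e01 : 0 < e <= 1 by rewrite e0.
have sq_near s : `|deviation e y s ^+ 2 - c s ^+ 2| <= K0 * B * e.
  rewrite subr_sqr normrM [leRHS]mulrAC ler_pM//; first exact: deviation_near.
  apply: (le_trans (ler_normD _ _)); apply: lerD; last exact: velocity_bound.
  exact: deviation_bound.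
have := deviation_decay e01 t0 y_eta; rewrite -/X.
have := sq_near 0; rewrite ler_norml => /andP[_ n0].
have := sq_near t; rewrite ler_norml => /andP[nt _].
have : X * (- (K0 * B * e)) <= X * (deviation e y t ^+ 2 - c t ^+ 2) by rewrite ler_wpM2l.
rewrite -/(c t) -/(c 0) mulrBr.
by move: n0 s1; rewrite -/(c 0); lra.
Unshelve. all: by end_near. Qed.
End traffic.

(** * Truncation to an interval and extension of the velocity function *)

Section clamping.
Context {R : realType}.
Implicit Types (lo hi x y : R) (f : R -> R).

(** Retraction of the line onto [lo, hi]. *)
Definition clamp lo hi x : R := Num.max lo (Num.min x hi).

Lemma clamp_bound lo hi x : lo <= hi -> lo <= clamp lo hi x <= hi.
Proof. by move=> lh; rewrite /clamp le_max lexx ge_max lh ge_min lexx orbT. Qed.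

Lemma clamp_id lo hi x : lo <= x <= hi -> clamp lo hi x = x.
Proof. by move=> /andP[lx xh]; rewrite /clamp min_l// max_r. Qed.

Lemma clamp_lip lo hi x y : `|clamp lo hi x - clamp lo hi y| <= `|x - y|.
Proof.
have := ler_norm (x - y); have := ler_norm (y - x); rewrite (distrC y).
rewrite /clamp ler_norml.
case: (leP x hi) => ?; case: (leP y hi) => ?;
(case: (leP lo x) => ?); (case: (leP lo y) => ?); (case: (leP lo hi) => ?); lra.
Qed.

Lemma has_derivative_on_quotient (a c : R) f (f' : R -> R) x (e : R) :
  has_derivative_on `[a, c] f f' -> a <= x <= c -> 0 < e ->
  exists2 d, 0 < d & forall y, `|x - y| < d -> y != x -> a <= y <= c ->
    `|f' x - (f y - f x) / (y - x)| <= e.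
Proof.
move=> df xac e0; have xD : `[a, c]%classic x by rewrite /= in_itv.
have /cvgrPdist_le /(_ _ e0) := df x xD.
move=> [d /= d0 Hd]; exists d; first exact: d0.
by move=> y xy yx yac; apply: (Hd y); rewrite //= in_itv.
Qed.

Lemma clamp_continuous (a c : R) f (f' : R -> R) : a <= c ->
  has_derivative_on `[a, c] f f' -> continuous (f \o clamp a c).
Proof.
move=> ac df x; set z := clamp a c x.
have zac : a <= z <= c by exact: clamp_bound.
have [d d0 Hd] := has_derivative_on_quotient df zac ltr01.
apply/cvgrPdist_le => e e0; near=> y.
have xy : `|x - y| < d by near: y; apply: cvgr_dist_lt.
have xye : `|x - y| * (`|f' z| + 1) <= e.
  rewrite -ler_pdivlMr; last by rewrite ltr_wpDl.
  by near: y; apply: cvgr_dist_le => //; rewrite divr_gt0// ltr_wpDl.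
rewrite /= -/z; set w := clamp a c y.
have zw : `|z - w| <= `|x - y| by exact: clamp_lip.
have [->|wz] := eqVneq w z; first by rewrite subrr normr0 ltW.
have H := Hd w (le_lt_trans zw xy) wz (clamp_bound y ac).
apply: le_trans xye; have wz0 : w - z != 0 by rewrite subr_eq0.
rewrite distrC (_ : f w - f z = (w - z) * ((f w - f z) / (w - z))); last by rewrite mulrC divfK.
rewrite normrM ler_pM// 1?distrC//.
have := ler_normD (f' z) ((f w - f z) / (w - z) - f' z); rewrite subrKC.
by move: H; rewrite distrC; lra.
Unshelve. all: by end_near. Qed.

Lemma clamp_is_derive (a c : R) f (f' : R -> R) x : a < x < c ->
  has_derivative_on `[a, c] f f' -> is_derive x 1 (f \o clamp a c) (f' x).
Proof.
move=> /andP[ax xc] df.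
have xac : a <= x <= c by rewrite !ltW.
have H : (fun h : R => h^-1 *: ((f \o clamp a c) (h *: 1 + x) - (f \o clamp a c) x)) @ 0^' --> f' x.
  apply/cvgrPdist_le => e e0.
  have [d d0 Hd] := has_derivative_on_quotient df xac e0.
  near=> k.
  have k0 : k != 0 by near: k; exact: nbhs_dnbhs_neq.
  have k1 : `|k| < d by near: k; exact: dnbhs0_lt.
  have k2 : `|k| <= x - a by near: k; apply: dnbhs0_le; rewrite subr_gt0.
  have k3 : `|k| <= c - x by near: k; apply: dnbhs0_le; rewrite subr_gt0.
  have kac : a <= k + x <= c by move: k2 k3; rewrite !ler_norml; lra.
  rewrite /= /GRing.scale /= mulr1 !clamp_id// mulrC.
  have := Hd (k + x); rewrite addrK; apply => //.
    by rewrite opprD addrCA subrr addr0 normrN.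
  by rewrite -subr_eq0 addrK.
by apply: DeriveDef; [apply/cvg_ex; exists (f' x)|exact/cvg_lim].
Unshelve. all: by end_near. Qed.

(** The extension integrates v' composed with the retraction onto
[0, rhomax], so it inherits the upper bound on the derivative; a lower bound
comes from continuity of v' on a compact interval. *)
Lemma velocity_extension (rhomax vmax' : R) (v v' : R -> R) :
  0 < rhomax -> C2_on `[0, rhomax] v v' ->
  (forall x, 0 <= x <= rhomax -> v' x <= vmax') ->
  exists vh dvh : R -> R, exists L : R,
    [/\ forall x, is_derive x 1 vh (dvh x), forall x, - L <= dvh x,
      forall x, dvh x <= vmax' & forall x, 0 <= x <= rhomax -> vh x = v x].
Proof.
move=> rm0 [dv [v'' [dv' _]]] v'_le; have rm0' := ltW rm0.
have cdvh := clamp_continuous rm0' dv'.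
have [F dF] := primitive_exists cdvh.
have [c cD cmin] := EVT_min rm0' (continuous_subspaceT cdvh).
exists (fun x => F x - F 0 + v 0), (v' \o clamp 0 rhomax), (- (v' \o clamp 0 rhomax) c).
split => x.
- have dFx := dF x.
  rewrite (_ : (fun x => _) = F + cst (v 0 - F 0)); last first.
    by apply/funext => z; rewrite !fctE /=; ring.
  by apply: is_derive_eq; rewrite addr0.
- rewrite opprK /= -[in leRHS](@clamp_id 0 rhomax (clamp 0 rhomax x)) ?clamp_bound//.
  by apply: cmin; rewrite in_itv/= clamp_bound.
- by rewrite /= v'_le// clamp_bound.
- move=> /andP[x0 xm]; move: x0; rewrite le_eqVlt => /predU1P[<-|x0].
    by rewrite subrr add0r.
  pose g z := (v \o clamp 0 rhomax) z - F z.
  have dg z : z \in `]0, x[ -> is_derive z 1 g 0.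
    rewrite in_itv /= => /andP[z0 zx]; have zm : 0 < z < rhomax by rewrite z0 (lt_le_trans zx).
    have d1 := clamp_is_derive zm dv; have d2 := dF z.
    rewrite (_ : g = (v \o clamp 0 rhomax) - F)//.
    apply: is_derive_eq; rewrite /= clamp_id ?subrr//.
    by rewrite !ltW//; have /andP[] := zm.
  have cg : {within `[0, x], continuous g}.
    apply: continuous_subspaceT => z; apply: cvgB; first exact: (clamp_continuous rm0' dv).
    exact: is_derive1_continuous (dF z).
  have [z _] := MVT x0 dg cg.
  rewrite mul0r /g /= !clamp_id; [lra|by rewrite lexx rm0'|by rewrite (ltW x0)].
Qed.
End clamping.

(** * The truncated density *)

Section almost_everywhere_tools.
Context {R : realType}.
Local Notation mu := (@lebesgue_measure R).

Lemma ae_eq_Rintegral (D : set R) (f g : R -> R) : measurable D ->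
  measurable_fun D f -> measurable_fun D g ->
  {ae mu, forall x, f x = g x} ->
  \int[mu]_(x in D) f x = \int[mu]_(x in D) g x.
Proof.
move=> mD mf mg fg; congr fine; apply: ae_eq_integral => //.
- exact/measurable_EFinP.
- exact/measurable_EFinP.
- by move: fg; apply: (@filterS _ _ (ae_filter_ringOfSetsType mu)) => x fgx Dx; rewrite fgx.
Qed.

(** Translation invariance for continuous integrands, by comparing values of
one primitive. *)
Lemma intR_window_shift (f : R -> R) (a c d : R) : a < c -> continuous f ->
  intR (fun x => f x * window (a + d) (c + d) x) =
  intR (fun x => f (x + d) * window a c x).
Proof.
move=> ac cf; have [F dF] := primitive_exists cf.
have acd : a + d < c + d by rewrite ltrD2r.
have cfd : continuous (fun x => f (x + d)).
  move=> x; apply: (@continuous_comp _ _ _ (fun x : R => x + d) f); last exact: cf.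
  by apply: cvgD; [exact: cvg_id|exact: cvg_cst].
have dFd (x : R) : is_derive x 1 (fun x => F (x + d)) (f (x + d)).
  have dl : is_derive x 1 (fun x : R => x + d) 1.
    by apply: is_derive_eq; rewrite addr0.
  by have := @is_derive1_comp _ F (fun x : R => x + d) x _ _ (dF (x + d)) dl; rewrite mulr1.
by rewrite (ftc2_intR acd cf dF) (ftc2_intR ac cfd dFd).
Qed.
End almost_everywhere_tools.

Section regularization.
Context {R : realType}.
Local Notation mu := (@lebesgue_measure R).
Variables (rhomax eta : R) (v rho0 : R -> R) (rho : R -> R -> R).
Hypothesis rho0_bound : forall x, 0 < rho0 x <= rhomax.
Hypothesis rho_sol : weak_solution rhomax eta v rho0 rho.
Hypothesis rho_max_principle : maximum_principle rho0 rho.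

Let rmin := inf (range rho0).

(** For negative times the density is frozen at its initial value, so that
continuity in t holds on the whole line. *)
Definition regularized (t x : R) : R :=
  clamp (inf (range rho0)) rhomax (rho (pos t) x).

Lemma rmin_ge0 : 0 <= rmin.
Proof.
apply: lb_le_inf; first by exists (rho0 0); exists 0.
by move=> _ [x _ <-]; have /andP[/ltW] := rho0_bound x.
Qed.

Lemma rmin_le : rmin <= rhomax.
Proof.
have /andP[_ h] := rho0_bound 0; apply: le_trans h.
apply: ge_inf; last by exists 0.
by exists 0 => _ [x _ <-]; have /andP[/ltW] := rho0_bound x.
Qed.

Lemma regularized_bound t x : rmin <= regularized t x <= rhomax.
Proof. exact/clamp_bound/rmin_le. Qed.

Lemma regularized_ae t : 0 <= t -> {ae mu, forall x, regularized t x = rho t x}.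
Proof.
move=> t0; have H1 := weak_solution_range rho_sol t0.
have H2 := rho_max_principle t0.
move: H1 H2; apply: (@filterS2 _ _ (ae_filter_ringOfSetsType mu)) => x /andP[_ xm] /andP[xl _].
by rewrite /regularized /pos max_r// clamp_id// xl.
Qed.

Lemma rho_measurable t : 0 <= t -> measurable_fun setT (rho t).
Proof.
move=> t0.
have mD : measurable ([set u : R | 0 <= u] `*` [set: R]).
  apply: measurableX => //.
  by rewrite (_ : [set u | 0 <= u] = `[0, +oo[%classic)//; apply/seteqP; split => u /=; rewrite in_itv/= andbT.
apply: (@measurable_comp _ _ _ _ _ _ ([set u : R | 0 <= u] `*` [set: R])
  (fun z : R * R => rho z.1 z.2) _ (pair t)) => //.
- by move=> _ [x _ <-].
- exact: weak_solution_measurable rho_sol.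
Qed.

Lemma regularized_measurable t : measurable_fun setT (regularized t).
Proof.
apply: measurable_maxr; first exact: measurable_cst.
apply: measurable_minr; last exact: measurable_cst.
exact: (rho_measurable (pos_ge0 t)).
Qed.

Lemma regularized_field : L1loc_field rhomax regularized.
Proof.
split => [t|t x|t N e e0]; first exact: regularized_measurable.
  have := regularized_bound t x; have := rmin_ge0; rewrite ler_norml; lra.
have pc : pos s @[s --> t] --> pos t.
  by apply: (@lipschitz_continuous _ _ 1) => x y; rewrite mul1r pos_lip.
have := weak_solution_continuous rho_sol (- N) N (pos_ge0 t).
move=> /cvgrPdist_le /(_ _ e0) H.
have H' : \forall s \near t, `|0 - \int[mu]_(x in `[- N, N]) `|rho (pos s) x - rho (pos t) x| | <= e.
  have H2 : nbhs (pos t) (fun u : R => 0 <= u ->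
    `|0 - \int[mu]_(x in `[- N, N]) `|rho u x - rho (pos t) x| | <= e) := H.
  have H3 : \forall s \near t, 0 <= pos s ->
    `|0 - \int[mu]_(x in `[- N, N]) `|rho (pos s) x - rho (pos t) x| | <= e.
    exact: (pc _ H2).
  apply: filterS H3 => s Hs.
  exact: Hs (pos_ge0 s).
apply: filterS H' => s; rewrite sub0r normrN => Hs.
apply: le_trans Hs; apply: le_trans (ler_norm _).
rewrite le_eqVlt; apply/orP; left; apply/eqP.
rewrite -intR_itv; apply: ae_eq_Rintegral => //.
- apply: measurable_funS (measurableT) _ _ => //.
  by apply: measurableT_comp => //; apply: measurable_funB; exact: regularized_measurable.
- apply: measurable_funS (measurableT) _ _ => //.
  by apply: measurableT_comp => //; apply: measurable_funB; exact: (rho_measurable (pos_ge0 _)).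
- have H1 := regularized_ae (pos_ge0 s); have H2 := regularized_ae (pos_ge0 t).
  have pp u : pos (pos u) = pos u :> R by rewrite {1}/pos max_r// pos_ge0.
  move: H1 H2; apply: (@filterS2 _ _ (ae_filter_ringOfSetsType mu)) => x.
  by rewrite /regularized !pp => -> ->.
Qed.
End regularization.

(** * The balance law and the theorem *)

Section balance_law.
Context {R : realType}.
Local Notation mu := (@lebesgue_measure R).
Variables (rhomax eta b vbar rhobar L lmax : R) (v vh dvh rho0 : R -> R).
Variable rho : R -> R -> R.
Hypothesis eta_gt0 : 0 < eta.
Hypothesis rhobar_bound : 0 < rhobar <= rhomax.
Hypothesis v_rhobar : v rhobar = vbar.
Hypothesis rho0_bound : forall x, 0 < rho0 x <= rhomax.
Hypothesis rho0_right : forall x, b <= x -> rho0 x = rhobar.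
Hypothesis rho_sol : weak_solution rhomax eta v rho0 rho.
Hypothesis rho_max_principle : maximum_principle rho0 rho.
Hypothesis vh_derive : forall x : R, is_derive x 1 vh (dvh x).
Hypothesis dvh_ge : forall x, - L <= dvh x.
Hypothesis dvh_le : forall x, dvh x <= lmax.
Hypothesis lmax0 : lmax < 0.
Hypothesis vh_v : forall x, 0 <= x <= rhomax -> vh x = v x.

Let r := regularized rhomax rho0 rho.
Let rmin := inf (range rho0).

Let r_field : L1loc_field rhomax r.
Proof. exact: regularized_field rho0_bound rho_sol rho_max_principle. Qed.

Let r_ae t : 0 <= t -> {ae mu, forall x, r t x = rho t x}.
Proof. exact: regularized_ae rho_sol rho_max_principle t. Qed.

Let r_ge t x : rmin <= r t x.
Proof. by have /andP[] := regularized_bound rho rho0_bound t x. Qed.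

Let rmin0 : 0 <= rmin. Proof. exact: rmin_ge0 rho0_bound. Qed.

Let vh_rhobar : vh rhobar = vbar.
Proof. by rewrite vh_v//; have /andP[/ltW -> ->] := rhobar_bound. Qed.

Lemma nonlocal_velocity_regularized t x : 0 <= t ->
  nonlocal_velocity v eta rho t x = velocity eta vh r t x.
Proof.
move=> t0; rewrite /nonlocal_velocity /velocity /averaged.
have -> : \int[mu]_(y in `[x, x + eta]) rho t y = intR (fun y => r t y * window x (x + eta) y).
  rewrite -intR_itv; apply: ae_eq_Rintegral => //.
  - by apply: measurable_funS (measurableT) _ _ => //; exact: rho_measurable rho_sol t t0.
  - by apply: measurable_funS (measurableT) _ _ => //; exact: (field_measurable r_field).
  - by move: (r_ae t0); apply: (@filterS _ _ (ae_filter_ringOfSetsType mu)) => y ->.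
rewrite -vh_v//.
exact: (averaged_bound eta_gt0 rmin0 r_field r_ge t x).
Qed.

Lemma regularized_initial f : tame f -> (forall x, x < b -> f x = 0) ->
  intR (fun x => r 0 x * f x) = rhobar * intR f.
Proof.
move=> tf f0; rewrite -intRZ//.
have [mf _] := tf.
apply: ae_eq_Rintegral => //.
- by apply: measurable_funM => //; exact: (field_measurable r_field).
- exact: measurable_funM.
- have H1 := r_ae (lexx 0); have H2 := weak_solution_initial rho_sol.
  move: H1 H2; apply: (@filterS2 _ _ (ae_filter_ringOfSetsType mu)) => x -> ->.
  by have [bx|xb] := leP b x; [rewrite rho0_right|rewrite f0// !mulr0].
Qed.

Local Notation front := (front b vbar).
Local Notation pairing := (pairing b vbar).
Local Notation flow := (relative_flow eta vbar vh r).

Let flow_field : L1loc_field (rhomax * (L * rhomax)) flow.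
Proof.
exact: (relative_flow_field eta_gt0 rmin0 r_field r_ge vh_derive dvh_ge dvh_le lmax0 vh_rhobar rhobar_bound).
Qed.

Section moving_test_function.
Variables (y z s s' e d : R).
Hypothesis s0 : 0 < s.
Hypothesis s'0 : 0 < s'.
Hypothesis e0 : 0 < e.
Hypothesis d0 : 0 < d.

Let psi x := ramp e (x - y) - ramp e (x - z).
Let psi' x := bump e (x - y) - bump e (x - z).
Let chi t := ramp d (t - s) - ramp d (t - s').
Let chi' t := bump d (t - s) - bump d (t - s').

Let ramp_diff_derive c p q (x : R) : 0 < c ->
  is_derive x 1 (fun x => ramp c (x - p) - ramp c (x - q)) (bump c (x - p) - bump c (x - q)).
Proof.
move=> c0; have r1 := ramp_taylor c0 (x - p); have r2 := ramp_taylor c0 (x - q).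
apply: (@quadratic_is_derive _ _ _ _ (2 / c ^+ 2 + 2 / c ^+ 2)) => h.
move: (r1 h) (r2 h); rewrite !(addrAC x h) mulrDl.
by rewrite !ler_norml; lra.
Qed.

(** The product test functions in the moving frame. *)
Definition moving_test (t x : R) : R := chi t * psi (x - front t).

Lemma moving_test_derive_x (t x : R) :
  is_derive x 1 (moving_test t) (chi t * psi' (x - front t)).
Proof.
have dpsi := ramp_diff_derive y z (x - front t) e0.
have dl : is_derive x 1 (fun x : R => x - front t) 1.
  by apply: is_derive_eq; rewrite subr0.
have dc := @is_derive1_comp _ psi (fun x : R => x - front t) x _ _ dpsi dl.
rewrite (_ : moving_test t = cst (chi t) * (psi \o (fun x : R => x - front t)))//.
by apply: is_derive_eq; rewrite /GRing.scale /= /psi'; ring.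
Qed.

Lemma moving_test_derive_t (t x : R) :
  is_derive t 1 (moving_test ^~ x)
    (chi' t * psi (x - front t) - vbar * chi t * psi' (x - front t)).
Proof.
have dpsi := ramp_diff_derive y z (x - front t) e0.
have dchi := ramp_diff_derive s s' t d0.
have dl : is_derive t 1 (fun t : R => x - front t) (- vbar).
  rewrite (_ : (fun t : R => x - front t) = cst (x - b) - (cst vbar * id)); last first.
    by apply/funext => u; rewrite !fctE /front /=; ring.
  by apply: is_derive_eq; rewrite /GRing.scale /=; ring.
have dc := @is_derive1_comp _ psi (fun t : R => x - front t) t _ _ dpsi dl.
rewrite (_ : moving_test ^~ x = chi * (psi \o (fun t : R => x - front t)))//.
by apply: is_derive_eq; rewrite /GRing.scale /= /psi' /chi'; ring.
Qed.

Lemma moving_test_is_test : test_function moving_test.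
Proof.
have cpsi : continuous psi := kernel_continuous (ramp_kernel e0 y z).
have cpsi' : continuous psi' := kernel_continuous (bump_kernel e0 y z).
have cchi : continuous chi := kernel_continuous (ramp_kernel d0 s s').
have cchi' : continuous chi' := kernel_continuous (bump_kernel d0 s s').
have c1 : continuous (fun w : R * R => w.1) by move=> w; exact: cvg_fst.
have cl : continuous (fun w : R * R => w.2 - front w.1).
  move=> w; apply: cvgB; first exact: cvg_snd.
  apply: cvgD; first exact: cvg_cst.
  by apply: cvgM; [exact: cvg_cst|exact: cvg_fst].
have comp1 (f : R -> R) : continuous f -> continuous (fun w : R * R => f w.1).
  by move=> cf w; apply: (@continuous_comp _ _ _ fst f); [exact: cvg_fst|exact: cf].
have comp2 (f : R -> R) : continuous f -> continuous (fun w : R * R => f (w.2 - front w.1)).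
  by move=> cf w; apply: (@continuous_comp _ _ _ (fun w : R * R => w.2 - front w.1) f); [exact: cl|exact: cf].
split.
- move=> t x; split; first by have [] := moving_test_derive_t t x.
  by have [] := moving_test_derive_x t x.
- rewrite (_ : (fun _ => _) = (fun w : R * R => chi' w.1 * psi (w.2 - front w.1)
     - vbar * chi w.1 * psi' (w.2 - front w.1))); last first.
    by apply/funext => w; rewrite derive1E; have [_ ->] := moving_test_derive_t w.1 w.2.
  move=> w; apply: cvgB; apply: cvgM.
  + exact: comp1.
  + exact: comp2.
  + by apply: cvgM; [exact: cvg_cst|exact: comp1].
  + exact: comp2.
- rewrite (_ : (fun _ => _) = (fun w : R * R => chi w.1 * psi' (w.2 - front w.1))); last first.
    by apply/funext => w; rewrite derive1E; have [_ ->] := moving_test_derive_x w.1 w.2.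
  by move=> w; apply: cvgM; [exact: comp1|exact: comp2].
- pose N := Num.max s s' + 2 * d.
  pose M := `|y| + `|z| + 2 * e.
  have N0 : 0 <= N by rewrite addr_ge0 ?le_max ?(ltW s0)// mulr_ge0// ltW.
  have M0 : 0 <= M by rewrite !addr_ge0// mulr_ge0// ltW.
  exists (Num.min s s'), (N + M + `|b| + `|vbar| * N).
  have vN : 0 <= `|vbar| * N by rewrite mulr_ge0.
  split; first by rewrite lt_min s0.
  move=> t x; rewrite mulf_eq0 negb_or => /andP[chi0 psi0].
  have tN : Num.min s s' <= t <= N.
    apply/negPn/negP => out; move/negP: chi0; apply.
    by rewrite -normr_le0 (le_trans (ramp_diff_le d0 _ _ _))// window_out.
  have xM : `|x - front t| <= M.
    rewrite leNgt; apply/negP => out; move/negP: psi0; apply.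
    by apply/eqP; exact: (kernel_supp (ramp_kernel e0 y z)).
  have t0 : 0 <= t.
    by have /andP[h _] := tN; apply: le_trans h; rewrite le_min !ltW.
  have /andP[h1 h2] := tN.
  have nb := normr_ge0 b.
  split; first by rewrite h1; lra.
  have ft : `|front t| <= `|b| + `|vbar| * N.
    rewrite (le_trans (ler_normD _ _))// lerD2l normrM (ger0_norm t0).
    by rewrite ler_wpM2l.
  have := ler_normD (x - front t) (front t); rewrite subrK.
  by lra.
Qed.

(** The derivative of the test function in t contributes -vbar chi psi',
which turns the flux r V into the flux relative to the front. *)
Lemma weak_balance :
  \int[mu]_(t in `]0, +oo[) (chi' t * pairing r psi t + chi t * pairing flow psi' t) = 0.
Proof.
rewrite -[RHS](weak_solution_equation rho_sol moving_test_is_test).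
apply: eq_Rintegral => t; rewrite inE /= in_itv /= andbT => t0.
have tpsi : tame (fun x => psi (x - front t)) := tame_kernel_shift _ (ramp_kernel e0 y z).
have tpsi' : tame (fun x => psi' (x - front t)) := tame_kernel_shift _ (bump_kernel e0 y z).
have t1 := tame_field_mul t r_field tpsi.
have t2 := tame_field_mul t flow_field tpsi'.
rewrite /pairing -!intRZ// -intRD; [|exact: tameZ..].
have mpsi := tpsi.1; have mpsi' := tpsi'.1.
have mV : measurable_fun setT (velocity eta vh r t).
  apply: continuous_measurable_fun.
  exact: (velocity_continuous eta_gt0 rmin0 r_field r_ge vh_derive dvh_ge dvh_le lmax0).
transitivity (intR (fun x => rho t x * (chi' t * psi (x - front t) - vbar * chi t * psi' (x - front t))
   + rho t x * velocity eta vh r t x * (chi t * psi' (x - front t)))); last first.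
  apply: eq_intR => x; rewrite !derive1E.
  have [_ ->] := moving_test_derive_t t x; have [_ ->] := moving_test_derive_x t x.
  by rewrite nonlocal_velocity_regularized// ltW.
apply: ae_eq_Rintegral => //.
- apply: measurable_funD; apply: measurable_funM => //; first exact: t1.1.
  exact: t2.1.
- have mr := rho_measurable rho_sol (ltW t0).
  apply: measurable_funD; apply: measurable_funM => //.
  + by apply: measurable_funB; apply: measurable_funM.
  + exact: measurable_funM.
  + exact: measurable_funM.
- move: (r_ae (ltW t0)); apply: (@filterS _ _ (ae_filter_ringOfSetsType mu)) => x rx.
  by rewrite /relative_flow -rx; ring.
Qed.
End moving_test_function.

Lemma regularized_balance e y z : 0 < e -> forall t : R, 0 < t ->
  is_derive t 1 (pairing r (fun x => ramp e (x - y) - ramp e (x - z)))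
    (pairing flow (fun x => bump e (x - y) - bump e (x - z)) t).
Proof.
move=> e0; apply: du_bois_reymond.
- exact: (pairing_continuous r_field (ramp_kernel e0 y z)).
- exact: (pairing_continuous flow_field (bump_kernel e0 y z)).
- by move=> s s' d s0 s'0 d0; exact: weak_balance.
Qed.

Lemma lyapunov_decay t : 0 <= t ->
  lyapunov v eta b vbar rho t <=
    lyapunov v eta b vbar rho 0 * expR (2 / eta * lmax * rmin * t).
Proof.
move=> t0.
pose f u x := (velocity eta vh r u x - vbar) ^+ 2.
have cf u : continuous (f u).
  move=> x.
  have cV : {for x, continuous (fun x => velocity eta vh r u x - vbar)}.
    apply: cvgB; last exact: cvg_cst.
    exact: (velocity_continuous eta_gt0 rmin0 r_field r_ge vh_derive dvh_ge dvh_le lmax0).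
  rewrite (_ : f u = (fun x => (velocity eta vh r u x - vbar) * (velocity eta vh r u x - vbar))).
    by apply: cvgM; exact: cV.
  by apply/funext => z; rewrite /f expr2.
have LE u : 0 <= u -> lyapunov v eta b vbar rho u =
    intR (fun x => f u (x + front u) * window (- eta) 0 x).
  move=> u0; have e00 : - eta < 0 by rewrite oppr_lt0.
  rewrite -(intR_window_shift _ e00 (cf u)) add0r (addrC (- eta)) -intR_itv.
  by apply: eq_Rintegral => x _; rewrite nonlocal_velocity_regularized.
rewrite !LE// mulrC.
have tf u : tame (fun x => f u (x + front u) * window (- eta) 0 x).
  have cfu : continuous (fun x => f u (x + front u)).
    move=> x; apply: (@continuous_comp _ _ _ (fun x : R => x + front u) (f u)); last exact: cf.
    by apply: cvgD; [exact: cvg_id|exact: cvg_cst].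
  exact: tame_mul_window.
rewrite -intRZ//; apply: le_intR => //; first exact: tameZ.
move=> x; rewrite mulrA.
have [H|H] := boolP (- eta <= x <= 0); last by rewrite window_out// !mulr0.
rewrite ler_wpM2r ?window_ge0// [leRHS]mulrC (addrC x) (addrC x).
have /andP[xe _] := H.
have := velocity_decay eta_gt0 rmin0 r_field r_ge vh_derive dvh_ge dvh_le lmax0
  vh_rhobar rhobar_bound regularized_initial regularized_balance t0 xe.
by rewrite /f /front mulr0 addr0.
Qed.
End balance_law.

Theorem proposition3p1 (R : realType) (rhomax eta b : R) (v v' : R -> R)
  (vmax' vbar rhobar : R) (rho0 : R -> R) (rho : R -> R -> R)
  (rhomax_gt0 : 0 < rhomax) (eta_gt0 : 0 < eta)
  (v_C2 : C2_on `[0, rhomax] v v')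
  (v_ge0 : forall r, 0 <= r <= rhomax -> 0 <= v r)
  (v'_lt0 : forall r, 0 <= r <= rhomax -> v' r < 0)
  (vmax'_lt0 : vmax' < 0)
  (v'_le : forall r, 0 <= r <= rhomax -> v' r <= vmax')
  (vbar_bound : 0 <= vbar < v 0)
  (rhobar_bound : 0 < rhobar <= rhomax)
  (v_rhobar : v rhobar = vbar)
  (rho0_bound : forall x, 0 < rho0 x <= rhomax)
  (rho0_BV : bounded_total_variation rho0)
  (rho0_right : forall x, b <= x -> rho0 x = rhobar)
  (rho_sol : weak_solution rhomax eta v rho0 rho)
  (rho_max_principle : maximum_principle rho0 rho)
  (t : R) (t_ge0 : 0 <= t) :
  let rhomin := inf (range rho0) in
  let L := lyapunov v eta b vbar rho in
  L t <= L 0 * expR (2 / eta * vmax' * rhomin * t).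
Proof.
have [vh [dvh [K [vh_derive dvh_ge dvh_le vh_v]]]] :=
  velocity_extension rhomax_gt0 v_C2 v'_le.
exact: (lyapunov_decay eta_gt0 rhobar_bound v_rhobar rho0_bound rho0_right
  rho_sol rho_max_principle vh_derive dvh_ge dvh_le vmax'_lt0 vh_v t_ge0).
Qed.
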